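(* Let $\kappa\in(-1,1)$ and let $F=F(t,y)$, defined for $t\ge0$ and $\Re y>0$ and analytic in $y$, be a solution of $$\partial_tF+\frac14(y^2-1)\,\partial_y(F^2)=\frac{\kappa^2}{2}\,y(y^2-1),\qquad F(0,y)=y .$$ Then for $\Re y>0$ $$F^2(t,\phi(t,y))=\kappa^2\phi^2(t,y)+(1-\kappa^2)y^2,$$ for all $t\ge 0$ such that the trajectory $s\mapsto\phi(s,y)$ exists and stays in $\{\Re>0\}$ on $[0,t]$, where $\phi$ is the flow with $\phi(0,y)=y$ given by $$\phi^2(t,y)=1-\frac{4a\lambda e^{\sqrt a\,t}}{(b+\lambda e^{\sqrt a\,t})^2-4\kappa^2a},$$ $$a=\kappa^2+(1-\kappa^2)y^2,\qquad b=a+\kappa^2,\qquad \lambda=\frac{(1-\kappa^2)^2y^2}{(1+\sqrt a)^2}(1-y^2).$$ Equivalently, for the function $H(t,z)=F\!\left(t,\frac{1+z}{1-z}\right)$, $|z|<1$ (the Herglotz transform of $\mu_t$), one has $$H^2(t,\psi(t,z))=\kappa^2\left(\frac{1+\psi(t,z)}{1-\psi(t,z)}\right)^2+(1-\kappa^2)\left(\frac{1+z}{1-z}\right)^2,$$ with $$\psi(t,z)=\frac{\phi(t,y)-1}{\phi(t,y)+1},\qquad z=\frac{y-1}{y+1}.$$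
   Context: Here $\sqrt{\cdot}$ is the principal branch, and $\phi(t,y)$ is the square root with positive real part of $\phi^2(t,y)$ as long as the trajectory stays in the open right half-plane. Setting of the paper (motivating $H$): $(\mathscr{A},\tau)$ is a von Neumann algebra with faithful tracial state, $P\in\mathscr{A}$ an orthogonal projection with $\tau(P)=\theta\in(0,1)$, $S=2P-{\bf 1}$, $\kappa=\tau(S)=2\theta-1$, $Y=(Y_t)_{t\ge0}$ a free unitary Brownian motion (normalized by $\tau(Y_t)=e^{-t/2}$, $Y_0={\bf 1}$) $\star$-free from $P$, $\mu_t$ is the spectral distribution on the unit circle $\mathbb{T}$ of $SY_tSY_t^\star$, and $H(t,z)=\int_{\mathbb{T}}\frac{\xi+z}{\xi-z}\,\mu_t(d\xi)$ for $|z|<1$; the function $F(t,y)=H(t,z)$ with $y=\frac{1+z}{1-z}$ is a solution of the displayed equation. *)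

(* Defs.v *)
(* Stdlib reals with Coquelicot. *)
From Stdlib Require Import Reals Lra Psatz.
From Coquelicot Require Import Coquelicot.

Open Scope R_scope.
Open Scope C_scope.

Definition Cexp (z : C) : C :=
  ((exp (Re z) * cos (Im z))%R, (exp (Re z) * sin (Im z))%R).

(* Principal branch: on the cut (-oo,0) the root with positive imaginary part
   is taken.  The two lemmas below characterize it. *)
Definition Csqrt (z : C) : C :=
  (sqrt ((Cmod z + Re z) / 2),
   ((if Rlt_dec (Im z) 0 then -1 else 1) * sqrt ((Cmod z - Re z) / 2))%R).

Lemma Csqrt_sqr (z : C) : Csqrt z ^ 2 = z.
Proof.
destruct z as [x y].
assert (Hm : (Cmod (x, y) * Cmod (x, y) = x * x + y * y)%R).
{ unfold Cmod; simpl fst; simpl snd.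
  rewrite sqrt_sqrt; [ring | nra]. }
assert (H0 := Cmod_ge_0 (x, y)).
unfold Csqrt; simpl Re; simpl Im.
set (m := Cmod (x, y)) in *.
assert (Hp : (0 <= (m + x) / 2)%R) by nra.
assert (Hn : (0 <= (m - x) / 2)%R) by nra.
assert (Hs : (sqrt ((m + x) / 2) * sqrt ((m - x) / 2) = Rabs y / 2)%R).
{ rewrite <- sqrt_mult by assumption.
  replace ((m + x) / 2 * ((m - x) / 2))%R with (Rsqr (y / 2))
    by (unfold Rsqr; nra).
  rewrite sqrt_Rsqr_abs, Rabs_div, (Rabs_right 2) by lra; reflexivity. }
assert (Ep := sqrt_sqrt _ Hp); assert (En := sqrt_sqrt _ Hn).
set (p := sqrt ((m + x) / 2)) in *; set (q := sqrt ((m - x) / 2)) in *.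
destruct (Rlt_dec y 0) as [Hy | Hy].
- rewrite Rabs_left in Hs by lra.
  apply injective_projections; simpl; nra.
- rewrite Rabs_right in Hs by lra.
  apply injective_projections; simpl; nra.
Qed.

Lemma Csqrt_principal (z : C) :
  (0 <= Re (Csqrt z))%R /\ (Re (Csqrt z) = 0%R -> (0 <= Im (Csqrt z))%R).
Proof.
destruct z as [x y].
unfold Csqrt; simpl Re; simpl Im; split; [apply sqrt_pos | intros H].
destruct (Rlt_dec y 0) as [Hy | Hy];
  [| rewrite Rmult_1_l; apply sqrt_pos].
exfalso; revert H; apply Rgt_not_eq, sqrt_lt_R0.
assert (Hm : (Cmod (x, y) * Cmod (x, y) = x * x + y * y)%R).
{ unfold Cmod; simpl fst; simpl snd.
  rewrite sqrt_sqrt; [ring | nra]. }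
assert (H0 := Cmod_ge_0 (x, y)); nra.
Qed.

Definition half_plane (y : C) : Prop := (0 < Re y)%R.

Definition analytic_on (D : C -> Prop) (f : C -> C) : Prop :=
  forall y0 : C, D y0 ->
  exists (r : R) (c : nat -> C), (0 < r)%R /\
    forall y : C, (Cmod (y - y0) < r)%R ->
      is_pseries (K := C_AbsRing) (V := C_NormedModule) c (y - y0) (f y).

(* Derivative at [t] of a map defined on [0,+oo): one-sided at [t = 0]. *)
Definition is_time_derive (f : R -> C) (t : R) (l : C) : Prop :=
  filterdiff (K := R_AbsRing) (U := R_NormedModule) (V := C_R_NormedModule)
    f (within (fun s : R => (0 <= s)%R) (locally t)) (fun h : R => scal h l).

(* Only the values of [F] on [0,+oo) x half_plane matter.  A solution is
   understood in the classical sense, hence jointly continuous; together with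
   analyticity in [y] and the equation, this makes [F] jointly C^1. *)
Record pde_solution (kappa : R) (F : R -> C -> C) : Prop := {
  pde_analytic : forall t : R, (0 <= t)%R -> analytic_on half_plane (F t);
  pde_continuous :
    continuous_on (T := prod_UniformSpace R_UniformSpace C_UniformSpace)
      (U := C_UniformSpace)
      (fun p => (0 <= fst p)%R /\ half_plane (snd p))
      (fun p => F (fst p) (snd p));
  pde_equation :
    forall (t : R) (y : C), (0 <= t)%R -> half_plane y ->
    exists dt dy : C,
      is_time_derive (fun s => F s y) t dt /\
      is_derive (K := C_AbsRing) (V := C_NormedModule)
        (fun w : C => F t w ^ 2) y dy /\
      dt + / 4 * (y ^ 2 - 1) * dy
        = RtoC kappa ^ 2 / 2 * y * (y ^ 2 - 1);
  pde_initial : forall y : C, half_plane y -> F 0%R y = y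
}.

Definition flow_a (kappa : R) (y : C) : C := kappa ^ 2 + (1 - kappa ^ 2) * y ^ 2.

Definition flow_b (kappa : R) (y : C) : C := flow_a kappa y + kappa ^ 2.

Definition flow_lambda (kappa : R) (y : C) : C :=
  (1 - kappa ^ 2) ^ 2 * y ^ 2 / (1 + Csqrt (flow_a kappa y)) ^ 2 * (1 - y ^ 2).

Definition flow_exp (kappa t : R) (y : C) : C := Cexp (Csqrt (flow_a kappa y) * t).

Definition phi_den (kappa t : R) (y : C) : C :=
  (flow_b kappa y + flow_lambda kappa y * flow_exp kappa t y) ^ 2
  - 4 * kappa ^ 2 * flow_a kappa y.

Definition phi_sq (kappa t : R) (y : C) : C :=
  1 - 4 * flow_a kappa y * flow_lambda kappa y * flow_exp kappa t y
      / phi_den kappa t y.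

Definition phi (kappa t : R) (y : C) : C := Csqrt (phi_sq kappa t y).

(* The trajectory issued from [y] exists on [0,t] when no pole of [phi_sq] is
   met.  As [phi] is the principal root, [half_plane (phi kappa s y)] says
   that [phi_sq kappa s y] has a square root with positive real part. *)
Definition trajectory_in_half_plane (kappa t : R) (y : C) : Prop :=
  forall s : R, (0 <= s <= t)%R ->
    phi_den kappa s y <> 0 /\ half_plane (phi kappa s y).

Definition disc_to_half_plane (z : C) : C := (1 + z) / (1 - z).
Definition half_plane_to_disc (y : C) : C := (y - 1) / (y + 1).

Lemma half_plane_to_discK (y : C) :
  half_plane y -> disc_to_half_plane (half_plane_to_disc y) = y.
Proof.
intros Hy; unfold half_plane, disc_to_half_plane, half_plane_to_disc in *.
assert (H1 : y + 1 <> 0).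
{ intros E; apply (f_equal Re) in E; simpl in E; unfold Re in *; lra. }
assert (E : 1 - (y - 1) / (y + 1) = 2 / (y + 1))
  by (replace (RtoC 2) with (1 + 1) by (rewrite <- RtoC_plus; f_equal; ring);
      field; exact H1).
rewrite E; replace (1 + (y - 1) / (y + 1)) with (2 * y / (y + 1));
  [field; exact H1 |].
replace (RtoC 2) with (1 + 1) by (rewrite <- RtoC_plus; f_equal; ring).
field; exact H1.
Qed.

Definition H_of (F : R -> C -> C) (t : R) (z : C) : C :=
  F t (disc_to_half_plane z).

Definition psi (kappa t : R) (z : C) : C :=
  half_plane_to_disc (phi kappa t (disc_to_half_plane z)).

(* Main.v *)
(* The flow [phi] is a characteristic of the equation: there is an explicit
   curve [G] with [phi' = (phi^2 - 1) G / 2], [G' = kappa^2 phi (phi^2 - 1) / 2],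
   [G 0 = y] and [G^2 = kappa^2 phi^2 + (1 - kappa^2) y^2].  By the equation,
   [u = F (t, phi) - G] satisfies [u' = - (phi^2 - 1) (dF/dy) u / 2] and
   [u 0 = 0], so [u] vanishes by Gronwall's inequality.

   This needs Taylor bounds for [F t] that are uniform in [t], whereas
   analyticity alone gives power series whose radii may depend on [t].  They
   come from the continuity of [F] by applying the maximum modulus principle
   to the divided differences of [F t].  That principle needs no
   integration: at an interior maximum of [|g|^2 + eps |y|^2] the mean over
   four points around it would exceed the maximum. *)

(* The curve [G] need not be guessed. The square [phi^2] is rational in [E = lambda e^(sqrt a t)],
   and [phi' = (phi^2 - 1) G / 2] forces [phi G = (phi^2)' / (phi^2 - 1)] wherever [phi^2] differs
   from 1; this is again rational in [E]. Since [E' = sqrt a E], the differential equations and the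
   quadratic relation for [phi^2] and [phi G] are identities between rational functions. Square
   roots enter only when [phi] is divided out, which [Re phi > 0] permits.

   The obstacle is to differentiate [F (t, phi t)]: the hypotheses give partial derivatives, but no
   continuity of [dF/dy] in [t]. A second-order Taylor remainder uniform in [t] makes up for it:
   [dF/dy] is then close to a difference quotient with a fixed increment, and that quotient is
   continuous in [t]. The remainder comes from Cauchy estimates: subtracting the value at the centre
   and dividing by [y - y0] multiplies a bound on the disc of radius [rho] by [2 / rho], and doing
   so twice gives the second-order term. *)
Require Import Defs.
From Stdlib Require Import Reals Lra Psatz Classical ClassicalEpsilon List.
From Coquelicot Require Import Coquelicot.

Open Scope R_scope.
Open Scope C_scope.

(** * Local expansions *)

(* Order-[n] Taylor expansion at 0 with bounded remainder, phrased through
   iterated divided differences so that stability under products and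
   inverses is an immediate induction. *)
Fixpoint expands (n : nat) (f : C -> C) : Prop :=
  match n with
  | O => exists K d : R, (0 < d)%R /\
           forall z, (Cmod z < d)%R -> (Cmod (f z) <= K)%R
  | S m => exists (g : C -> C) (d : R), (0 < d)%R /\ expands m g /\
           forall z, (Cmod z < d)%R -> f z = f 0 + z * g z
  end.

Lemma expands_local n (f g : C -> C) (d : R) :
  (0 < d)%R -> (forall z, (Cmod z < d)%R -> f z = g z) ->
  expands n f -> expands n g.
Proof.
intros Hd E; destruct n as [|n]; simpl.
- intros (K & e & He & HK); exists K, (Rmin d e); split.
  { now apply Rmin_glb_lt. }
  intros z Hz; rewrite <- E.
  + apply HK, Rlt_le_trans with (1 := Hz), Rmin_r.
  + apply Rlt_le_trans with (1 := Hz), Rmin_l.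
- intros (h & e & He & Hh & HK); exists h, (Rmin d e); split.
  { now apply Rmin_glb_lt. }
  split; [exact Hh |].
  intros z Hz; rewrite <- !E.
  + apply HK, Rlt_le_trans with (1 := Hz), Rmin_r.
  + rewrite Cmod_0; lra.
  + apply Rlt_le_trans with (1 := Hz), Rmin_l.
Qed.

Lemma expands_pred n (f : C -> C) : expands (S n) f -> expands n f.
Proof.
revert f; induction n as [|n IH]; intros f (g & d & Hd & Hg & E).
- destruct Hg as (K & e & He & HK).
  exists (Cmod (f 0) + d * Rabs K)%R, (Rmin d e); split.
  { now apply Rmin_glb_lt. }
  intros z Hz.
  assert (Hz1 := Rlt_le_trans _ _ _ Hz (Rmin_l d e)).
  assert (Hz2 := Rlt_le_trans _ _ _ Hz (Rmin_r d e)).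
  rewrite E by assumption.
  eapply Rle_trans; [apply Cmod_triangle |].
  rewrite Cmod_mult; apply Rplus_le_compat_l.
  apply Rmult_le_compat; try apply Cmod_ge_0; try lra.
  apply Rle_trans with K; [now apply HK | apply Rle_abs].
- exists g, d; auto.
Qed.

Lemma expands_le m n (f : C -> C) : (m <= n)%nat -> expands n f -> expands m f.
Proof.
intros H; induction H as [|n H IH]; [trivial |].
intros Hf; apply IH, expands_pred, Hf.
Qed.

Lemma expands_const n (c : C) : expands n (fun _ => c).
Proof.
revert c; induction n as [|n IH]; intros c.
- exists (Cmod c), 1%R; split; [lra | intros; lra].
- exists (fun _ => 0), 1%R; split; [lra | split; [apply IH |]].
  intros; ring.
Qed.

Lemma expands_plus n (f g : C -> C) :
  expands n f -> expands n g -> expands n (fun z => f z + g z).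
Proof.
revert f g; induction n as [|n IH]; intros f g; simpl.
- intros (K & d & Hd & HK) (L & e & He & HL).
  exists (K + L)%R, (Rmin d e); split; [now apply Rmin_glb_lt |].
  intros z Hz.
  assert (Hz1 := Rlt_le_trans _ _ _ Hz (Rmin_l d e)).
  assert (Hz2 := Rlt_le_trans _ _ _ Hz (Rmin_r d e)).
  eapply Rle_trans; [apply Cmod_triangle |].
  apply Rplus_le_compat; auto.
- intros (f' & d & Hd & Hf & HK) (g' & e & He & Hg & HL).
  exists (fun z => f' z + g' z), (Rmin d e).
  split; [now apply Rmin_glb_lt | split; [now apply IH |]].
  intros z Hz.
  rewrite (HK z), (HL z); [ring | |].
  + apply Rlt_le_trans with (1 := Hz), Rmin_r.
  + apply Rlt_le_trans with (1 := Hz), Rmin_l.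
Qed.

(** Leibniz rule for divided differences: [f g = f(0) g(0) + z (f g' + g(0) f')]. The undivided
    factor [f] remains on the right, so it is also needed at the lower order, which [expands_pred]
    gives. *)
Lemma expands_mult n (f g : C -> C) :
  expands n f -> expands n g -> expands n (fun z => f z * g z).
Proof.
revert f g; induction n as [|n IH]; intros f g.
- intros (K & d & Hd & HK) (L & e & He & HL).
  exists (K * L)%R, (Rmin d e); split; [now apply Rmin_glb_lt |].
  intros z Hz.
  assert (Hz1 := Rlt_le_trans _ _ _ Hz (Rmin_l d e)).
  assert (Hz2 := Rlt_le_trans _ _ _ Hz (Rmin_r d e)).
  rewrite Cmod_mult; apply Rmult_le_compat; try apply Cmod_ge_0; auto.
- intros Hf0 Hg0.
  assert (Hf1 := expands_pred _ _ Hf0).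
  destruct Hf0 as (f' & d & Hd & Hf & HK), Hg0 as (g' & e & He & Hg & HL).
  exists (fun z => f z * g' z + g 0 * f' z), (Rmin d e).
  split; [now apply Rmin_glb_lt | split].
  + apply expands_plus; apply IH; auto using expands_const.
  + intros z Hz.
    rewrite (HL z); [rewrite (HK z); [ring|] |].
    * apply Rlt_le_trans with (1 := Hz), Rmin_l.
    * apply Rlt_le_trans with (1 := Hz), Rmin_r.
Qed.

(** By [1 / (c + z) = 1 / c - (z / c) / (c + z)], the divided difference is a constant multiple of
    the function itself, so the induction closes at once. *)
Lemma expands_inv n (c : C) : c <> 0 -> expands n (fun z => / (c + z)).
Proof.
intros Hc.
assert (Hm : (0 < Cmod c)%R) by now apply Cmod_gt_0.
assert (Hlow : forall z, (Cmod z < Cmod c / 2)%R -> (Cmod c / 2 <= Cmod (c + z))%R).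
{ intros z Hz.
  assert (H := Cmod_triangle (c + z) (- z)).
  rewrite Cmod_opp in H; replace (c + z + - z) with c in H by ring; lra. }
assert (Hnz : forall z, (Cmod z < Cmod c / 2)%R -> c + z <> 0).
{ intros z Hz; apply Cmod_gt_0; specialize (Hlow z Hz); lra. }
induction n as [|n IH].
- exists (/ (Cmod c / 2))%R, (Cmod c / 2)%R; split; [lra |].
  intros z Hz; rewrite Cmod_inv by auto.
  apply Rinv_le_contravar; [lra | auto].
- exists (fun z => - / c * / (c + z)), (Cmod c / 2)%R; split; [lra | split].
  + apply expands_mult; [apply expands_const | exact IH].
  + intros z Hz; specialize (Hnz z Hz); field.
    now split.
Qed.

(** Convergence at [r / 2] bounds the partial sums there by some [M], hence each term by [2 * M].
    For [|z| < r / 4] the terms are then dominated by a geometric series of ratio [1 / 2]. *)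
Lemma pseries_bounded (c : nat -> C) (r : R) (f : C -> C) :
  (0 < r)%R ->
  (forall z, (Cmod z < r)%R ->
     is_pseries (K := C_AbsRing) (V := C_NormedModule) c z (f z)) ->
  expands 0 f.
Proof.
intros Hr H.
assert (Hx : Cmod (RtoC (r / 2)) = (r / 2)%R)
  by (rewrite Cmod_R, Rabs_right; lra).
assert (H0 := H (RtoC (r / 2)) ltac:(lra)).
destruct (filterlim_bounded
  (fun N => sum_n (fun k => scal (pow_n (RtoC (r / 2) : C_AbsRing) k) (c k : C_NormedModule)) N)
  (ex_intro _ _ H0)) as (M & HM).
assert (HP : forall (z : C) k, pow_n (z : C_AbsRing) k = (z ^ k : C)).
{ intros z k; induction k as [|k IH]; [reflexivity |].
  simpl; now rewrite <- IH. }
assert (Ht : forall k, (Cmod (c k) * (r / 2) ^ k <= 2 * M)%R).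
{ intros k.
  replace (Cmod (c k) * (r / 2) ^ k)%R with (Cmod (RtoC (r / 2) ^ k * c k))
    by (rewrite Cmod_mult, Cmod_pow, Hx; ring).
  destruct k as [|k].
  - specialize (HM O); rewrite sum_O, HP in HM.
    change (Cmod (RtoC (r / 2) ^ 0 * c 0%nat) <= M)%R in HM.
    assert (Hp := Cmod_ge_0 (RtoC (r / 2) ^ 0 * c 0%nat)); lra.
  - assert (H1 := HM (S k)); assert (H2 := HM k).
    rewrite sum_Sn, HP in H1.
    set (s := sum_n _ k) in *.
    change (Cmod (s + RtoC (r / 2) ^ S k * c (S k)) <= M)%R in H1.
    change (Cmod s <= M)%R in H2.
    assert (H3 := Cmod_triangle (s + RtoC (r / 2) ^ S k * c (S k)) (- s)).
    rewrite Cmod_opp in H3.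
    replace (s + RtoC (r / 2) ^ S k * c (S k) + - s)
      with (RtoC (r / 2) ^ S k * c (S k)) in H3 by ring.
    lra. }
exists (4 * M)%R, (r / 4)%R; split; [lra |].
intros z Hz.
assert (Hz1 : (Cmod z < r)%R) by lra.
assert (HM0 : (0 <= M)%R).
{ specialize (Ht O); assert (Hp := Cmod_ge_0 (c O)); simpl in Ht; lra. }
(* The right-hand side is the exact partial sum of [2 * M * (/ 2) ^ k], the form in which the
   induction goes through. *)
assert (Hs : forall N, (Cmod (sum_n (fun k => scal (pow_n (z : C_AbsRing) k) (c k : C_NormedModule)) N)
   <= 4 * M - 2 * M * (/ 2) ^ N)%R).
{ assert (Hb : forall k, (Cmod (z ^ k * c k) <= 2 * M * (/ 2) ^ k)%R).
  { intros k; rewrite Cmod_mult, Cmod_pow.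
    apply Rle_trans with ((r / 2 * / 2) ^ k * Cmod (c k))%R.
    - apply Rmult_le_compat_r; [apply Cmod_ge_0 |].
      apply pow_incr; split; [apply Cmod_ge_0 | lra].
    - rewrite Rpow_mult_distr.
      replace ((r / 2) ^ k * (/ 2) ^ k * Cmod (c k))%R
        with (Cmod (c k) * (r / 2) ^ k * (/ 2) ^ k)%R by ring.
      apply Rmult_le_compat_r; [apply pow_le; lra | apply Ht]. }
  induction N as [|N IH].
  - rewrite sum_O, HP; specialize (Hb O).
    change (Cmod (z ^ 0 * c 0%nat) <= 4 * M - 2 * M * (/ 2) ^ 0)%R; simpl in *; lra.
  - rewrite sum_Sn, HP; set (s := sum_n _ N) in *.
    change (Cmod (s + z ^ S N * c (S N)) <= 4 * M - 2 * M * (/ 2) ^ S N)%R.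
    eapply Rle_trans; [apply Cmod_triangle |].
    specialize (Hb (S N)); simpl in *; lra. }
assert (Hl := filterlim_comp _ _ _ _ _ _ _ _ (H z Hz1) (filterlim_norm (f z))).
apply (is_lim_seq_le _ (fun _ => 4 * M)%R (norm (f z : C_NormedModule)) (4 * M)%R)
  with (2 := Hl) (3 := is_lim_seq_const _).
intros N; eapply Rle_trans; [apply Hs |].
assert (0 <= (/ 2) ^ N)%R by (apply pow_le; lra); nra.
Qed.

Lemma pseries_expands n (c : nat -> C) (r : R) (f : C -> C) :
  (0 < r)%R ->
  (forall z, (Cmod z < r)%R ->
     is_pseries (K := C_AbsRing) (V := C_NormedModule) c z (f z)) ->
  expands n f.
Proof.
intros Hr; revert c f; induction n as [|n IH]; intros c f H.
- exact (pseries_bounded c r f Hr H).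
(* At 0 the quotient has to take its limit [c 1], so that it is the sum of the shifted series there
   too. *)
- exists (fun z : C => if excluded_middle_informative (z = RtoC 0) then c 1%nat
                   else / z * (f z - c 0%nat)), r.
  assert (H00 : f 0 = c 0%nat).
  { assert (H0 : is_pseries (K := C_AbsRing) (V := C_NormedModule) c (RtoC 0) (f 0))
      by (apply H; now rewrite Cmod_0).
    assert (H1 := is_pseries_0 (K := C_AbsRing) (V := C_NormedModule) c).
    exact (filterlim_locally_unique (K := C_AbsRing) (V := C_NormedModule) _ _ _ H0 H1). }
  split; [exact Hr | split].
  + apply IH with (c := PS_decr_1 c).
    intros z Hz; destruct (excluded_middle_informative (z = 0)) as [-> | Hn].
    * apply (is_pseries_0 (K := C_AbsRing) (V := C_NormedModule) (PS_decr_1 c)).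
    * apply (is_pseries_decr_1 (K := C_AbsRing) (V := C_NormedModule) c z (/ z)).
      -- change (/ z * z = 1); field; exact Hn.
      -- now apply H.
  + intros z Hz; destruct (excluded_middle_informative (z = 0)) as [-> | Hn].
    * ring.
    * rewrite H00; field; exact Hn.
Qed.

(** * Maximum modulus principle *)

Lemma Cmod_le_abs_sum (z : C) : (Cmod z <= Rabs (Re z) + Rabs (Im z))%R.
Proof.
assert (H := Cmod2_alt z).
assert (H1 := Rabs_pos (Re z)); assert (H2 := Rabs_pos (Im z)).
rewrite <- (pow2_abs (Re z)), <- (pow2_abs (Im z)) in H.
apply Rnot_lt_le; intros C0; nra.
Qed.

Lemma im_le_Cmod (z : C) : (Rabs (Im z) <= Cmod z)%R.
Proof. eapply Rle_trans; [apply Rmax_r | apply Rmax_Cmod]. Qed.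

Lemma list_max_attained {A : Type} (h : A -> R) (l : list A) :
  l <> nil -> exists a, In a l /\ forall b, In b l -> (h b <= h a)%R.
Proof.
induction l as [|x [|y l] IH]; intros Hl; [easy | |].
- exists x; split; [now left |].
  intros b [<- | []]; lra.
- destruct IH as (a & Ha & Hm); [easy |].
  destruct (Rle_dec (h x) (h a)) as [Hx | Hx].
  + exists a; split; [now right |].
    intros b [<- | Hb]; auto.
  + exists x; split; [now left |].
    intros b [<- | Hb]; [lra |].
    specialize (Hm b Hb); lra.
Qed.

(** Upper semicontinuity suffices. If no point were maximal, each point of the disc would have a
    neighbourhood on which [h] stays below some value [h q] with [q] in the disc. Finitely many of
    these neighbourhoods cover the disc, and the largest of the corresponding values [h q] would
    then lie below another of them. *)
Lemma disc_max_attained (h : C -> R) (y0 : C) (rho : R) :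
  (0 <= rho)%R ->
  (forall p, (Cmod (p - y0) <= rho)%R -> forall eps, (0 < eps)%R ->
     exists d, (0 < d)%R /\
       forall z, (Cmod z < d)%R -> (h (p + z)%C < h p + eps)%R) ->
  exists p, (Cmod (p - y0) <= rho)%R /\
    forall q, (Cmod (q - y0) <= rho)%R -> (h q <= h p)%R.
Proof.
intros Hrho Hh; apply NNPP; intros Hno.
(* The factor 2 passes from boxes to discs: coordinates that differ by less than [delta] give a
   modulus below [2 * delta]. A point outside the disc gets a neighbourhood that misses the disc,
   and [y0] as a filler value. *)
assert (Hc : forall t : Compactness.Tn 2 R, exists dq : posreal * C,
  (Cmod (snd dq - y0) <= rho)%R /\
  forall x : C, (Cmod (x - y0) <= rho)%R ->
    (Cmod (x - (fst t, fst (snd t))) < 2 * fst dq)%R -> (h x < h (snd dq))%R).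
{ intros (t1 & t2 & []); simpl.
  set (t := (t1, t2) : C).
  destruct (Rle_dec (Cmod (t - y0)) rho) as [Ht | Ht].
  - assert (Hq : exists q, (Cmod (q - y0) <= rho)%R /\ (h t < h q)%R).
    { apply NNPP; intros Hq; apply Hno; exists t; split; [exact Ht |].
      intros q Hq1; apply Rnot_lt_le; intros Hq2; apply Hq; now exists q. }
    destruct Hq as (q & Hq1 & Hq2).
    destruct (Hh t Ht (h q - h t)%R ltac:(lra)) as (d & Hd & Hd1).
    assert (Hd2 : (0 < d / 2)%R) by lra.
    exists (mkposreal _ Hd2, q); simpl; split; [exact Hq1 |].
    intros x _ Hx.
    replace x with (t + (x - t)) by ring.
    replace (h q) with (h t + (h q - h t))%R by ring.
    apply Hd1; fold t in Hx; lra.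
  - assert (Hd2 : (0 < (Cmod (t - y0) - rho) / 2)%R) by lra.
    exists (mkposreal _ Hd2, y0); simpl; split.
    { replace (y0 - y0) with (RtoC 0) by ring; rewrite Cmod_0; lra. }
    intros x Hx1 Hx2; exfalso; fold t in Hx2.
    assert (H := Cmod_triangle (t - x) (x - y0)).
    replace (t - x + (x - y0)) with (t - y0) in H by ring.
    rewrite <- Cmod_opp in Hx2; replace (- (x - t)) with (t - x) in Hx2 by ring.
    lra. }
destruct (choice _ Hc) as (dq & Hdq); clear Hc.
(* The cover is provided under a double negation only, which is harmless because the goal is
   [False]. The box is the square circumscribed about the disc. *)
apply (compactness_list 2 ((Re y0 - rho)%R, ((Im y0 - rho)%R, tt))
         ((Re y0 + rho)%R, ((Im y0 + rho)%R, tt)) (fun t => fst (dq t))).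
intros (l & Hl).
assert (Hcov : forall x : C, (Cmod (x - y0) <= rho)%R ->
  exists t, In t l /\ (h x < h (snd (dq t)))%R).
{ intros x Hx.
  assert (H1 := Rle_trans _ _ _ (re_le_Cmod (x - y0)) Hx).
  assert (H2 := Rle_trans _ _ _ (im_le_Cmod (x - y0)) Hx).
  destruct x as [x1 x2]; destruct y0 as [u1 u2]; simpl in H1, H2.
  apply Rabs_le_between in H1; apply Rabs_le_between in H2.
  destruct (Hl (x1, (x2, tt))) as (t & Ht & _ & Hc).
  { simpl; repeat split; lra. }
  exists t; split; [exact Ht |].
  apply (proj2 (Hdq t)); [exact Hx |].
  destruct t as (t1 & t2 & []); simpl in *.
  destruct Hc as (Hc1 & Hc2 & _).
  eapply Rle_lt_trans; [apply Cmod_le_abs_sum |]; simpl.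
  unfold Rminus in *; lra. }
assert (Hne : l <> nil).
{ intros ->; destruct (Hcov y0) as (t & [] & _).
  replace (y0 - y0) with (RtoC 0) by ring; now rewrite Cmod_0. }
destruct (list_max_attained (fun t => h (snd (dq t))) l Hne) as (t & Ht & Hm).
destruct (Hcov (snd (dq t)) (proj1 (Hdq t))) as (t' & Ht' & Hlt).
specialize (Hm t' Ht'); simpl in Hm; lra.
Qed.

(* The first- and second-order terms cancel in the mean over the four points
   [d, -d, i d, -i d], so the mean of [|g|^2] is at least [|g 0|^2] up to
   third order. *)
Lemma four_point_mean (g : C -> C) :
  expands 3 g ->
  exists K d0 : R, (0 < d0)%R /\ (0 <= K)%R /\
    forall d, (0 < d < d0)%R ->
    (4 * Cmod (g 0%C) ^ 2 - K * d ^ 3 <=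
     Cmod (g (RtoC d)%C) ^ 2 + Cmod (g (- RtoC d)%C) ^ 2
     + Cmod (g (Ci * RtoC d)%C) ^ 2 + Cmod (g (- (Ci * RtoC d))%C) ^ 2)%R.
Proof.
intros (g1 & d1 & Hd1 & (g2 & d2 & Hd2 & (g3 & d3 & Hd3 & (K & d4 & Hd4 & HK) & E3) & E2) & E1).
set (a := g1 0) in *; set (b := g2 0) in *; set (c := g 0) in *.
pose (B := (Cmod c + Cmod a + Cmod b)%R).
pose (L := Rabs K).
assert (HB : (0 <= B)%R)
  by (unfold B; assert (H1 := Cmod_ge_0 a); assert (H2 := Cmod_ge_0 b);
      assert (H3 := Cmod_ge_0 c); lra).
assert (HL : (0 <= L)%R) by apply Rabs_pos.
exists (8 * B * L)%R, (Rmin (Rmin 1 d1) (Rmin d2 (Rmin d3 d4))).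
(* Replacing [g] by its quadratic part [P] costs at most [2 |P| |S|], where [S] is the cubic
   remainder, [B] bounds [|P|] and [L * |z|^3] bounds [|S|]. Four such losses make up the constant
   [8 * B * L]. *)
assert (Hone : forall z, (Cmod z < Rmin (Rmin 1 d1) (Rmin d2 (Rmin d3 d4)))%R ->
  (Cmod (c + a * z + b * z ^ 2) ^ 2 - 2 * B * L * Cmod z ^ 3 <= Cmod (g z) ^ 2)%R).
{ intros z Hz.
  assert (Hz1 : (Cmod z < 1)%R).
  { eapply Rlt_le_trans; [exact Hz |]; eapply Rle_trans; apply Rmin_l. }
  rewrite E1, E2, E3.
  2,3,4: eapply Rlt_le_trans; [exact Hz |].
  2: eapply Rle_trans; [apply Rmin_r|]; eapply Rle_trans; [apply Rmin_r|]; apply Rmin_l.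
  2: eapply Rle_trans; [apply Rmin_r|]; apply Rmin_l.
  2: eapply Rle_trans; [apply Rmin_l|]; apply Rmin_r.
  assert (HR : (Cmod (g3 z) <= L)%R).
  { eapply Rle_trans; [apply HK | apply Rle_abs].
    eapply Rlt_le_trans; [exact Hz |].
    eapply Rle_trans; [apply Rmin_r|]; eapply Rle_trans; [apply Rmin_r|]; apply Rmin_r. }
  set (P := c + a * z + b * z ^ 2).
  replace (c + z * (a + z * (b + z * g3 z))) with (P + z ^ 3 * g3 z)
    by (unfold P; ring).
  assert (H0 := Cmod_ge_0 z).
  assert (HP : (Cmod P <= B)%R).
  { unfold P, B; eapply Rle_trans; [apply Cmod_triangle |].
    apply Rplus_le_compat.
    - eapply Rle_trans; [apply Cmod_triangle |]; apply Rplus_le_compat_l.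
      rewrite Cmod_mult; assert (H1 := Cmod_ge_0 a); nra.
    - rewrite Cmod_mult, Cmod_pow; assert (H1 := Cmod_ge_0 b).
      assert (Cmod z ^ 2 <= 1)%R by nra; nra. }
  assert (HS : (Cmod (z ^ 3 * g3 z) <= L * Cmod z ^ 3)%R).
  { rewrite Cmod_mult, Cmod_pow, Rmult_comm.
    apply Rmult_le_compat_r; [apply pow_le, H0 | exact HR]. }
  set (S := z ^ 3 * g3 z) in *.
  assert (HT := Cmod_triangle (P + S) (- S)).
  rewrite Cmod_opp in HT; replace (P + S + - S) with P in HT by ring.
  assert (H1 := Cmod_ge_0 P); assert (H2 := Cmod_ge_0 S); assert (H3 := Cmod_ge_0 (P + S)).
  assert (Hps : (Cmod P * Cmod S <= B * (L * Cmod z ^ 3))%R)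
    by (apply Rmult_le_compat; assumption).
  assert (Cmod P ^ 2 - 2 * (Cmod P * Cmod S) <= Cmod (P + S) ^ 2)%R.
  { destruct (Rle_dec (Cmod S) (Cmod P)); nra. }
  lra. }
split; [| split].
- repeat apply Rmin_glb_lt; lra.
- assert (0 <= B * L)%R by (now apply Rmult_le_pos); lra.
- intros d Hd.
  assert (M1 : Cmod (RtoC d) = d) by (rewrite Cmod_R, Rabs_right; lra).
  assert (M2 : Cmod (Ci * RtoC d) = d) by (rewrite Cmod_mult, M1, Cmod_Ci; ring).
  assert (Q1 := Hone (RtoC d)); assert (Q2 := Hone (- RtoC d)).
  assert (Q3 := Hone (Ci * RtoC d)); assert (Q4 := Hone (- (Ci * RtoC d))).
  rewrite M1 in Q1; rewrite Cmod_opp, M1 in Q2.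
  rewrite M2 in Q3; rewrite Cmod_opp, M2 in Q4.
  specialize (Q1 (proj2 Hd)); specialize (Q2 (proj2 Hd)).
  specialize (Q3 (proj2 Hd)); specialize (Q4 (proj2 Hd)).
  (* The sums of [w] and of [w^2] over the fourth roots of unity [w] vanish, so all cross terms
     cancel and only the squared moduli of the three coefficients remain. *)
  assert (Hsum : (4 * Cmod c ^ 2 <=
    Cmod (c + a * RtoC d + b * RtoC d ^ 2) ^ 2
    + Cmod (c + a * - RtoC d + b * (- RtoC d) ^ 2) ^ 2
    + Cmod (c + a * (Ci * RtoC d) + b * (Ci * RtoC d) ^ 2) ^ 2
    + Cmod (c + a * - (Ci * RtoC d) + b * (- (Ci * RtoC d)) ^ 2) ^ 2)%R).
  { rewrite !Cmod2_alt; destruct a as [a1 a2], b as [b1 b2], c as [c1 c2].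
    simpl.
    apply Rle_trans with (4 * (c1 ^ 2 + c2 ^ 2) + 4 * d ^ 2 * (a1 ^ 2 + a2 ^ 2)
      + 4 * d ^ 4 * (b1 ^ 2 + b2 ^ 2))%R.
    - assert (0 <= d ^ 2 * (a1 ^ 2 + a2 ^ 2))%R
        by (apply Rmult_le_pos; [apply pow2_ge_0 | nra]).
      assert (0 <= d ^ 4 * (b1 ^ 2 + b2 ^ 2))%R
        by (apply Rmult_le_pos; [apply pow_le; lra | nra]).
      nra.
    - right; ring. }
  lra.
Qed.

Lemma expands_continuous n (f : C -> C) :
  expands (S n) f -> forall eps, (0 < eps)%R ->
  exists d, (0 < d)%R /\
    forall z, (Cmod z < d)%R -> (Cmod (f z - f 0) < eps)%R.
Proof.
intros Hf eps He.
apply (expands_le 1) in Hf; [| apply le_n_S, Nat.le_0_l].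
destruct Hf as (g & d & Hd & (K & e & Hpe & HK) & E).
pose (L := (Rabs K + 1)%R).
assert (HL : (0 < L)%R) by (unfold L; assert (H := Rabs_pos K); lra).
assert (HeL : (0 < eps / L)%R) by now apply Rdiv_lt_0_compat.
exists (Rmin d (Rmin e (eps / L))); split.
{ repeat apply Rmin_glb_lt; assumption. }
intros z Hz.
assert (Hz1 := Rlt_le_trans _ _ _ Hz (Rmin_l _ _)).
assert (Hz2 := Rlt_le_trans _ _ _ Hz (Rmin_r _ _)).
assert (Hz3 := Rlt_le_trans _ _ _ Hz2 (Rmin_l _ _)).
assert (Hz4 := Rlt_le_trans _ _ _ Hz2 (Rmin_r _ _)).
rewrite (E z Hz1).
replace (f 0 + z * g z - f 0) with (z * g z) by ring.
rewrite Cmod_mult.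
specialize (HK z Hz3).
assert (HK1 : (Cmod (g z) <= L)%R) by (unfold L; assert (H := Rle_abs K); lra).
apply Rle_lt_trans with (Cmod z * L)%R.
- apply Rmult_le_compat_l; [apply Cmod_ge_0 | exact HK1].
- replace eps with (eps / L * L)%R by (field; lra).
  apply Rmult_lt_compat_r; assumption.
Qed.

(** The perturbation [eps * |q - y0|^2] makes the four-point inequality strict: its sum over the
    four points gains exactly [4 * eps * d^2], against a third-order loss for [|g|^2]. The maximum
    is therefore on the circle, where the perturbation equals [eps * rho^2], and [eps] is
    arbitrary. *)
Lemma maximum_modulus (g : C -> C) (y0 : C) (rho B : R) :
  (0 < rho)%R ->
  (forall p, (Cmod (p - y0) <= rho)%R -> expands 3 (fun z => g (p + z))) ->
  (forall p, Cmod (p - y0) = rho -> (Cmod (g p) <= B)%R) ->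
  forall p, (Cmod (p - y0) <= rho)%R -> (Cmod (g p) <= B)%R.
Proof.
intros Hrho Hg HB p Hp.
assert (HB0 : (0 <= B)%R).
{ apply Rle_trans with (2 := HB (y0 + RtoC rho)
    ltac:(replace (y0 + RtoC rho - y0) with (RtoC rho) by ring;
          rewrite Cmod_R, Rabs_right; lra)); apply Cmod_ge_0. }
assert (Hall : forall eps, (0 < eps)%R ->
  (Cmod (g p) ^ 2 <= B ^ 2 + eps * rho ^ 2)%R).
{ intros eps He.
  pose (h := fun q => (Cmod (g q) ^ 2 + eps * Cmod (q - y0) ^ 2)%R).
  assert (Hh : forall q, (Cmod (q - y0) <= rho)%R -> forall e, (0 < e)%R ->
     exists d, (0 < d)%R /\ forall z, (Cmod z < d)%R -> (h (q + z)%C < h q + e)%R).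
  { intros q Hq e Hpe.
    pose (A := (Cmod (g q) + 1)%R).
    assert (HA : (0 < A)%R) by (unfold A; assert (H := Cmod_ge_0 (g q)); lra).
    destruct (expands_continuous 2 _ (Hg q Hq) (Rmin 1 (e / (4 * A)))%R) as (d & Hd & Hc).
    { apply Rmin_glb_lt; [lra | apply Rdiv_lt_0_compat; lra]. }
    pose (D := (4 * eps * (rho + 1))%R).
    assert (HD : (0 < D)%R) by (unfold D; nra).
    exists (Rmin d (Rmin 1 (e / D))); split.
    { repeat apply Rmin_glb_lt; try lra; apply Rdiv_lt_0_compat; lra. }
    intros z Hz.
    assert (Hz1 := Rlt_le_trans _ _ _ Hz (Rmin_l _ _)).
    assert (Hz2 := Rlt_le_trans _ _ _ Hz (Rmin_r _ _)).
    assert (Hz3 := Rlt_le_trans _ _ _ Hz2 (Rmin_l _ _)).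
    assert (Hz4 := Rlt_le_trans _ _ _ Hz2 (Rmin_r _ _)).
    specialize (Hc z Hz1); rewrite Cplus_0_r in Hc.
    assert (Hc1 := Rlt_le_trans _ _ _ Hc (Rmin_l _ _)).
    assert (Hc2 := Rlt_le_trans _ _ _ Hc (Rmin_r _ _)).
    unfold h.
    assert (Ht := Cmod_triangle (g (q + z)%C - g q) (g q)).
    replace (g (q + z)%C - g q + g q) with (g (q + z)%C) in Ht by ring.
    assert (Hu := Cmod_triangle (q - y0) z).
    replace (q - y0 + z) with (q + z - y0) in Hu by ring.
    assert (P0 := Cmod_ge_0 (g (q + z)%C - g q)); assert (P1 := Cmod_ge_0 (g q)).
    assert (P2 := Cmod_ge_0 (g (q + z)%C)); assert (P3 := Cmod_ge_0 (q - y0)).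
    assert (P4 := Cmod_ge_0 z); assert (P5 := Cmod_ge_0 (q + z - y0)).
    assert (S1 : (Cmod (g (q + z)%C) ^ 2 < Cmod (g q) ^ 2 + e / 2)%R).
    { assert (Hx : (Cmod (g (q + z)%C - g q) * (4 * A) < e)%R).
      { apply Rmult_lt_reg_r with (/ (4 * A))%R; [apply Rinv_0_lt_compat; lra |].
        rewrite Rmult_assoc, Rinv_r, Rmult_1_r by lra; exact Hc2. }
      unfold A in Hx; nra. }
    assert (S2 : (Cmod (q + z - y0) ^ 2 * eps < Cmod (q - y0) ^ 2 * eps + e / 2)%R).
    { assert (Hx : (Cmod z * D < e)%R).
      { apply Rmult_lt_reg_r with (/ D)%R; [apply Rinv_0_lt_compat; lra |].
        rewrite Rmult_assoc, Rinv_r, Rmult_1_r by lra; exact Hz4. }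
      unfold D in Hx.
      assert (Cmod (q + z - y0) ^ 2 <= Cmod (q - y0) ^ 2 + Cmod z * (2 * (rho + 1)))%R by nra.
      nra. }
    lra. }
  destruct (disc_max_attained h y0 rho ltac:(lra) Hh) as (q & Hq & Hm).
  assert (Hqb : Cmod (q - y0) = rho).
  { destruct (Rle_lt_or_eq_dec _ _ Hq) as [Hlt | He0]; [exfalso | exact He0].
    destruct (four_point_mean _ (Hg q Hq)) as (K & d0 & Hd0 & HK & Hmean).
    (* Small enough for the four points to stay in the disc, for the mean inequality to apply, and
       for [K * d^3 < 4 * eps * d^2]. *)
    pose (d := (Rmin (rho - Cmod (q - y0)) (Rmin d0 (4 * eps / (K + 1))) / 2)%R).
    assert (Hd : (0 < Rmin (rho - Cmod (q - y0)) (Rmin d0 (4 * eps / (K + 1))))%R).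
    { repeat apply Rmin_glb_lt; try lra; apply Rdiv_lt_0_compat; lra. }
    assert (Hd1 : (d < rho - Cmod (q - y0))%R).
    { unfold d; assert (H := Rmin_l (rho - Cmod (q - y0)) (Rmin d0 (4 * eps / (K + 1)))); lra. }
    assert (Hd' := Rmin_r (rho - Cmod (q - y0)) (Rmin d0 (4 * eps / (K + 1)))).
    assert (Hd2 : (d < d0)%R).
    { unfold d; assert (H := Rmin_l d0 (4 * eps / (K + 1))); lra. }
    assert (Hd3 : (d * (K + 1) < 4 * eps)%R).
    { apply Rmult_lt_reg_r with (/ (K + 1))%R; [apply Rinv_0_lt_compat; lra |].
      rewrite Rmult_assoc, Rinv_r, Rmult_1_r by lra.
      unfold d; assert (H := Rmin_r d0 (4 * eps / (K + 1)));
      unfold Rdiv in *; lra. }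
    assert (Hd4 : (0 < d)%R) by (unfold d; lra).
    specialize (Hmean d (conj Hd4 Hd2)).
    rewrite Cplus_0_r in Hmean.
    assert (M1 : Cmod (RtoC d) = d) by (rewrite Cmod_R, Rabs_right; lra).
    assert (M2 : Cmod (Ci * RtoC d) = d) by (rewrite Cmod_mult, M1, Cmod_Ci; ring).
    assert (Hin : forall z, Cmod z = d -> (h (q + z)%C <= h q)%R).
    { intros z Hz; apply Hm.
      replace (q + z - y0) with (q - y0 + z) by ring.
      eapply Rle_trans; [apply Cmod_triangle | lra]. }
    assert (N1 := Hin (RtoC d) M1).
    assert (N2 := Hin (- RtoC d) ltac:(rewrite Cmod_opp; exact M1)).
    assert (N3 := Hin (Ci * RtoC d) M2).
    assert (N4 := Hin (- (Ci * RtoC d)) ltac:(rewrite Cmod_opp; exact M2)).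
    unfold h in N1, N2, N3, N4.
    assert (Hpar : (Cmod (q + RtoC d - y0) ^ 2 + Cmod (q + - RtoC d - y0) ^ 2
      + Cmod (q + Ci * RtoC d - y0) ^ 2 + Cmod (q + - (Ci * RtoC d) - y0) ^ 2
      = 4 * Cmod (q - y0) ^ 2 + 4 * d ^ 2)%R).
    { rewrite !Cmod2_alt; destruct q as [q1 q2], y0 as [u1 u2]; simpl; ring. }
    assert (K * d ^ 3 < 4 * eps * d ^ 2)%R.
    { replace (K * d ^ 3)%R with (d * K * d ^ 2)%R by ring.
      apply Rmult_lt_compat_r; [apply pow_lt, Hd4 | lra]. }
    nra. }
  specialize (Hm p Hp); unfold h in Hm; rewrite Hqb in Hm.
  specialize (HB q Hqb).
  assert (P0 := Cmod_ge_0 (g q)); assert (P1 := pow2_ge_0 (Cmod (p - y0))).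
  assert (Cmod (g q) ^ 2 <= B ^ 2)%R by nra.
  assert (0 <= eps * Cmod (p - y0) ^ 2)%R by (apply Rmult_le_pos; lra).
  lra. }
apply Rnot_lt_le; intros Hlt.
assert (Hr2 : (0 < rho ^ 2)%R) by now apply pow_lt.
assert (Hpos : (0 < Cmod (g p) ^ 2 - B ^ 2)%R) by nra.
specialize (Hall ((Cmod (g p) ^ 2 - B ^ 2) / (2 * rho ^ 2))%R
  ltac:(apply Rdiv_lt_0_compat; lra)).
replace ((Cmod (g p) ^ 2 - B ^ 2) / (2 * rho ^ 2) * rho ^ 2)%R
  with ((Cmod (g p) ^ 2 - B ^ 2) / 2)%R in Hall by (field; lra).
lra.
Qed.

(** * Cauchy estimates by repeated divided differences *)

(** The quotient [(f p - f y0) / (p - y0)] is bounded by [M / rho] on the circle, and the maximum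
    modulus principle carries this bound inside. Near [y0] the quotient is read off from the given
    expansion [g], which removes the singularity; at other points it expands as a product with an
    inverse. *)
Lemma divided_difference (f g : C -> C) (y0 : C) (rho M d : R) :
  (0 < rho)%R -> (0 < d)%R ->
  (forall p, (Cmod (p - y0) <= rho)%R -> expands 3 (fun z => f (p + z))) ->
  expands 3 g ->
  (forall z, (Cmod z < d)%R -> f (y0 + z) = f y0 + z * g z) ->
  (forall p, Cmod (p - y0) = rho -> (Cmod (f p - f y0) <= M)%R) ->
  exists G : C -> C,
    (forall z, (Cmod z < d)%R -> G (y0 + z) = g z) /\
    (forall p, f p = f y0 + (p - y0) * G p) /\
    (forall p, (Cmod (p - y0) <= rho)%R -> expands 3 (fun z => G (p + z))) /\
    (forall p, (Cmod (p - y0) <= rho)%R -> (Cmod (G p) <= M / rho)%R).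
Proof.
intros Hrho Hd Hf Hg Hfg HM.
pose (G := fun p => if Rlt_dec (Cmod (p - y0)) d then g (p - y0)
                    else / (p - y0) * (f p - f y0)).
assert (G1 : forall z, (Cmod z < d)%R -> G (y0 + z) = g z).
{ intros z Hz; unfold G; replace (y0 + z - y0) with z by ring.
  now destruct (Rlt_dec (Cmod z) d). }
assert (G2 : forall p, f p = f y0 + (p - y0) * G p).
{ intros p; unfold G; destruct (Rlt_dec (Cmod (p - y0)) d) as [H | H].
  - rewrite <- Hfg by exact H; f_equal; ring.
  - field; apply Cmod_gt_0; lra. }
assert (G3 : forall p, (Cmod (p - y0) <= rho)%R -> expands 3 (fun z => G (p + z))).
{ intros p Hp; destruct (classic (p - y0 = 0)) as [E | Hn].
  - apply (expands_local 3 g) with (d := d); [exact Hd | | exact Hg].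
    intros z Hz; replace p with y0 by (replace p with (p - y0 + y0) by ring; rewrite E; ring).
    symmetry; now apply G1.
  - apply (expands_local 3 (fun z => / (p - y0 + z) * (f (p + z) + - f y0)))
      with (d := Cmod (p - y0)); [now apply Cmod_gt_0 | |].
    + intros z Hz; rewrite (G2 (p + z)).
      replace (p + z - y0) with (p - y0 + z) by ring.
      field; intros E.
      replace z with (- (p - y0)) in Hz by (replace z with (- (p - y0) + (p - y0 + z)) by ring; rewrite E; ring).
      rewrite Cmod_opp in Hz; lra.
    + apply expands_mult; [now apply expands_inv |].
      apply expands_plus; [now apply Hf | apply expands_const]. }
exists G; repeat split; auto.
apply maximum_modulus; [exact Hrho | exact G3 |].
intros p Hp; specialize (HM p Hp).
rewrite G2 in HM; replace (f y0 + (p - y0) * G p - f y0) with ((p - y0) * G p) in HM by ring.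
rewrite Cmod_mult, Hp in HM.
apply Rmult_le_reg_l with rho; [exact Hrho |].
replace (rho * (M / rho))%R with M by (field; lra); exact HM.
Qed.

Lemma cauchy_taylor (f : C -> C) (y0 : C) (rho M : R) :
  (0 < rho)%R ->
  (forall p, (Cmod (p - y0) <= rho)%R -> forall n, expands n (fun z => f (p + z))) ->
  (forall p, (Cmod (p - y0) <= rho)%R -> (Cmod (f p) <= M)%R) ->
  exists c : C, (Cmod c <= 2 * M / rho)%R /\
    forall p, (Cmod (p - y0) <= rho)%R ->
      (Cmod (f p - f y0 - c * (p - y0)) <= 4 * M / rho ^ 2 * Cmod (p - y0) ^ 2)%R.
Proof.
intros Hrho Hf HM.
assert (H0 : (Cmod (y0 - y0) <= rho)%R).
{ replace (y0 - y0) with (RtoC 0) by ring; rewrite Cmod_0; lra. }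
(* Order 5 at the centre leaves order 3 after two divisions, as [maximum_modulus] requires. *)
destruct (Hf y0 H0 5%nat) as (g1 & d1 & Hd1 & Hg1 & E1).
rewrite Cplus_0_r in E1.
assert (Hdiff : forall (h : C -> C) (L : R),
  (forall p, (Cmod (p - y0) <= rho)%R -> (Cmod (h p) <= L)%R) ->
  forall p, Cmod (p - y0) = rho -> (Cmod (h p - h y0) <= 2 * L)%R).
{ intros h L HL p Hp.
  assert (Ht := Cmod_triangle (h p) (- h y0)); rewrite Cmod_opp in Ht.
  assert (Hy := HL y0 H0); assert (Hp1 := HL p ltac:(lra)).
  unfold Cminus; lra. }
destruct (divided_difference f g1 y0 rho (2 * M) d1 Hrho Hd1) as (G1 & P1 & Q1 & R1 & S1).
- intros p Hp; now apply Hf.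
- exact (expands_pred 3 g1 Hg1).
- exact E1.
- now apply Hdiff.
- destruct Hg1 as (g2 & d2 & Hd2 & Hg2 & E2).
  assert (HG1 : G1 y0 = g1 0).
  { rewrite <- (P1 0); [f_equal; ring | now rewrite Cmod_0]. }
  destruct (divided_difference G1 g2 y0 rho (2 * (2 * M / rho)) (Rmin d1 d2) Hrho)
    as (G2 & P2 & Q2 & R2 & S2).
  + now apply Rmin_glb_lt.
  + exact R1.
  + exact Hg2.
  + intros z Hz; rewrite HG1, P1, E2; [reflexivity | |].
    * apply Rlt_le_trans with (1 := Hz), Rmin_r.
    * apply Rlt_le_trans with (1 := Hz), Rmin_l.
  + now apply Hdiff.
  + exists (G1 y0); split; [now apply S1 |].
    intros p Hp.
    replace (f p - f y0 - G1 y0 * (p - y0)) with ((p - y0) ^ 2 * G2 p)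
      by (rewrite Q1, Q2; ring).
    rewrite Cmod_mult, Cmod_pow, Rmult_comm.
    apply Rmult_le_compat_r; [apply pow2_ge_0 |].
    eapply Rle_trans; [now apply S2 | right; field; lra].
Qed.

Lemma analytic_expands (D : C -> Prop) (f : C -> C) (p : C) n :
  analytic_on D f -> D p -> expands n (fun z => f (p + z)).
Proof.
intros Hf Hp; destruct (Hf p Hp) as (r & c & Hr & H).
apply pseries_expands with (c := c) (r := r); [exact Hr |].
intros z Hz; specialize (H (p + z)).
replace (p + z - p) with z in H by ring; now apply H.
Qed.

(** * Derivatives along curves *)

(** The set [D] of admissible times lets one notion serve for [F], which lives on nonnegative times,
    for the flow, defined at all real times, and for restrictions to short intervals. *)
Definition cderiv (D : R -> Prop) (f : R -> C) (t : R) (l : C) : Prop :=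
  forall eps : R, (0 < eps)%R -> exists d : R, (0 < d)%R /\
    forall s, D s -> (Rabs (s - t) < d)%R ->
      (Cmod (f s - f t - RtoC (s - t) * l) <= eps * Rabs (s - t))%R.

Definition time_domain (s : R) : Prop := (0 <= s)%R.

Lemma time_derive_cderiv (f : R -> C) (t : R) (l : C) :
  is_time_derive f t l -> cderiv time_domain f t l.
Proof.
intros (_ & H) eps He.
destruct (H t (fun P HP => filter_imp _ _ (fun x Hx _ => Hx) HP) (mkposreal _ He))
  as (d & Hd).
exists d; split; [apply cond_pos |].
intros s Hs Hst; specialize (Hd s Hst Hs).
rewrite <- Cmod_norm in Hd.
replace (f s - f t - RtoC (s - t) * l)
  with (minus (minus (f s : C_R_NormedModule) (f t))
          (scal (minus (s : R_NormedModule) t) (l : C_R_NormedModule)) : C).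
- exact Hd.
- apply injective_projections; simpl;
    unfold minus, plus, opp, scal, mult; simpl; unfold mult; simpl; ring.
Qed.

Lemma complex_derive_eps (f : C -> C) (y l : C) :
  is_derive (K := C_AbsRing) (V := C_NormedModule) f y l ->
  forall eps, (0 < eps)%R -> exists d, (0 < d)%R /\
    forall w, (Cmod (w - y) < d)%R ->
      (Cmod (f w - f y - (w - y) * l) <= eps * Cmod (w - y))%R.
Proof.
intros (_ & H) eps He.
destruct (H y (fun P HP => HP) (mkposreal _ He)) as (d & Hd).
exists d; split; [apply cond_pos |].
intros w Hw.
exact (Hd w Hw).
Qed.

(** * Local bounds for the solution and its derivative along a curve *)

Lemma pde_bounded (kappa : R) (F : R -> C -> C) (t0 : R) (y0 : C) :
  pde_solution kappa F -> (0 <= t0)%R -> half_plane y0 ->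
  exists eta M : R, (0 < eta)%R /\
    forall s y, (0 <= s)%R -> (Rabs (s - t0) < eta)%R -> (Cmod (y - y0) < eta)%R ->
      half_plane y /\ (Cmod (F s y) <= M)%R.
Proof.
intros HF Ht0 Hy0.
assert (Hc := pde_continuous _ _ HF (t0, y0) (conj Ht0 Hy0)).
destruct (proj1 (filterlim_locally _ _) Hc (mkposreal 1 Rlt_0_1)) as (d & Hd).
(* Balls of the product uniform structure on [C] are squares, so the radius 1 bounds the modulus
   only by [sqrt 2], hence the constant 2. *)
exists (Rmin d (Re y0)), (Cmod (F t0 y0) + 2)%R; split.
{ apply Rmin_glb_lt; [apply cond_pos | exact Hy0]. }
intros s y Hs Hst Hy.
assert (Hy1 := Rlt_le_trans _ _ _ Hy (Rmin_l _ _)).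
assert (Hy2 := Rlt_le_trans _ _ _ Hy (Rmin_r _ _)).
assert (Hp : half_plane y).
{ assert (H := Rle_lt_trans _ _ _ (re_le_Cmod _) Hy2).
  unfold half_plane; destruct y, y0; simpl in *.
  apply Rabs_def2 in H; lra. }
split; [exact Hp |].
assert (Hb : ball (M := prod_UniformSpace R_UniformSpace C_UniformSpace) (t0, y0) d (s, y)).
{ split; simpl.
  - apply Rlt_le_trans with (1 := Hst), Rmin_l.
  - exact (C_NormedModule_mixin_compat1 y0 y d Hy1). }
specialize (Hd (s, y) Hb (conj Hs Hp)).
apply (C_NormedModule_mixin_compat2 (F t0 y0) (F s y) (mkposreal 1 Rlt_0_1)) in Hd.
simpl in Hd; rewrite Rmult_1_r in Hd.
change (minus (F s y : C_NormedModule) (F t0 y0)) with (F s y - F t0 y0) in Hd.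
assert (Hs2 : (sqrt 2 < 2)%R).
{ rewrite <- (sqrt_Rsqr 2) at 2 by lra; apply sqrt_lt_1; unfold Rsqr; lra. }
assert (Ht := Cmod_triangle (F s y - F t0 y0) (F t0 y0)).
replace (F s y - F t0 y0 + F t0 y0) with (F s y) in Ht by ring.
lra.
Qed.

(** Links the derivative of the square, in which the equation is stated, to the Taylor coefficient
    of [f]. The increment of the square is [2 * f y * (f p - f y) + (f p - f y)^2], equal to
    [2 * f y * c * h] up to order [h^2]. *)
Lemma square_derive_unique (f : C -> C) (y c l : C) (eta K : R) :
  (0 < eta)%R ->
  (forall p, (Cmod (p - y) <= eta)%R ->
     (Cmod (f p - f y - c * (p - y)) <= K * Cmod (p - y) ^ 2)%R) ->
  is_derive (K := C_AbsRing) (V := C_NormedModule) (fun w => f w ^ 2) y l ->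
  l = 2 * f y * c.
Proof.
intros He HK Hl.
(* Coefficient of the error [h^2]: the squared increment, plus the Taylor remainder weighted by
   [2 * f y]; the 1 keeps it positive. *)
pose (L := ((Cmod c + Rabs K) ^ 2 + 2 * Cmod (f y) * Rabs K + 1)%R).
assert (HK0 := Rabs_pos K); assert (Hf0 := Cmod_ge_0 (f y)).
assert (Hc0 := Cmod_ge_0 c).
assert (HL : (0 < L)%R).
{ assert (0 <= Cmod (f y) * Rabs K)%R by now apply Rmult_le_pos.
  assert (H1 := pow2_ge_0 (Cmod c + Rabs K)); unfold L; lra. }
assert (E : l - 2 * f y * c = 0).
{ apply Cmod_eq_0; apply Rle_antisym; [| apply Cmod_ge_0].
  apply le_epsilon; intros eps Heps; rewrite Rplus_0_l.
  destruct (complex_derive_eps _ _ _ Hl (eps / 2)%R ltac:(lra)) as (d & Hd & Hder).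
  pose (h := (Rmin (Rmin 1 d) (Rmin eta (eps / L)) / 2)%R).
  assert (Hm : (0 < Rmin (Rmin 1 d) (Rmin eta (eps / L)))%R).
  { repeat apply Rmin_glb_lt; try lra; now apply Rdiv_lt_0_compat. }
  assert (Hm1 := Rmin_l (Rmin 1 d) (Rmin eta (eps / L))).
  assert (Hm2 := Rmin_r (Rmin 1 d) (Rmin eta (eps / L))).
  assert (Hm3 := Rmin_l 1 d); assert (Hm4 := Rmin_r 1 d).
  assert (Hm5 := Rmin_l eta (eps / L)); assert (Hm6 := Rmin_r eta (eps / L)).
  assert (Hh : (0 < h)%R) by (unfold h; lra).
  assert (Hh1 : (h < 1)%R) by (unfold h; lra).
  assert (Hhd : (h < d)%R) by (unfold h; lra).
  assert (Hhe : (h < eta)%R) by (unfold h; lra).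
  assert (HhL : (L * h <= eps / 2)%R).
  { apply Rle_trans with (L * (eps / L / 2))%R.
    - apply Rmult_le_compat_l; unfold h; lra.
    - right; field; lra. }
  set (p := y + RtoC h).
  assert (Ep : p - y = RtoC h) by (unfold p; ring).
  assert (Mh : Cmod (RtoC h) = h) by (rewrite Cmod_R, Rabs_right; lra).
  specialize (Hder p); rewrite Ep, Mh in Hder; specialize (Hder Hhd).
  specialize (HK p); rewrite Ep, Mh in HK; specialize (HK ltac:(lra)).
  set (r := f p - f y - c * RtoC h) in *.
  assert (HKr : (Cmod r <= Rabs K * h ^ 2)%R).
  { eapply Rle_trans; [exact HK |].
    apply Rmult_le_compat_r; [apply pow2_ge_0 | apply Rle_abs]. }
  assert (Hfp : f p = f y + c * RtoC h + r) by (unfold r; ring).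
  assert (Hfd : (Cmod (f p - f y) <= (Cmod c + Rabs K) * h)%R).
  { rewrite Hfp; replace (f y + c * RtoC h + r - f y) with (c * RtoC h + r) by ring.
    eapply Rle_trans; [apply Cmod_triangle |]; rewrite Cmod_mult, Mh.
    assert (Rabs K * h ^ 2 <= Rabs K * h)%R by (apply Rmult_le_compat_l; nra).
    lra. }
  assert (Hid : RtoC h * (l - 2 * f y * c)
     = - (f p ^ 2 - f y ^ 2 - RtoC h * l) + ((f p - f y) ^ 2 + 2 * f y * r))
    by (rewrite Hfp; ring).
  assert (Hb : (Cmod (RtoC h * (l - 2 * f y * c)) <= eps / 2 * h + L * h ^ 2)%R).
  { rewrite Hid; eapply Rle_trans; [apply Cmod_triangle |].
    rewrite Cmod_opp; apply Rplus_le_compat; [exact Hder |].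
    eapply Rle_trans; [apply Cmod_triangle |].
    rewrite Cmod_pow, !Cmod_mult, Cmod_R, (Rabs_right 2) by lra.
    assert (Cmod (f p - f y) ^ 2 <= (Cmod c + Rabs K) ^ 2 * h ^ 2)%R.
    { rewrite <- Rpow_mult_distr; apply pow_incr; split; [apply Cmod_ge_0 | exact Hfd]. }
    assert (2 * Cmod (f y) * Cmod r <= 2 * Cmod (f y) * (Rabs K * h ^ 2))%R
      by (apply Rmult_le_compat_l; lra).
    assert (0 <= h ^ 2)%R by apply pow2_ge_0.
    unfold L; nra. }
  rewrite Cmod_mult, Mh in Hb.
  apply Rmult_le_reg_l with h; [exact Hh |]; nra. }
replace l with (l - 2 * f y * c + 2 * f y * c) by ring; rewrite E; ring.
Qed.

(** A single [K] bounds the coefficient and the remainder at all nearby times and points, and the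
    equation takes the quasilinear form with [c] in the role of [dF/dy]. *)
Lemma pde_local (kappa : R) (F : R -> C -> C) (t0 : R) (y0 : C) :
  pde_solution kappa F -> (0 <= t0)%R -> half_plane y0 ->
  exists eta K : R, (0 < eta)%R /\ (0 <= K)%R /\
    forall s y, (0 <= s)%R -> (Rabs (s - t0) < eta)%R -> (Cmod (y - y0) < eta)%R ->
      exists c dt : C, (Cmod c <= K)%R /\
        (forall p, (Cmod (p - y) <= eta)%R ->
           (Cmod (F s p - F s y - c * (p - y)) <= K * Cmod (p - y) ^ 2)%R) /\
        cderiv time_domain (fun u => F u y) s dt /\
        dt = kappa ^ 2 / 2 * y * (y ^ 2 - 1) - (y ^ 2 - 1) / 2 * F s y * c.
Proof.
intros HF Ht0 Hy0.
destruct (pde_bounded kappa F t0 y0 HF Ht0 Hy0) as (eta & M & Heta & HM).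
(* Half the radius, so that discs of radius [e] centred within [e] of [y0] stay where [F] is
   bounded. *)
pose (e := (eta / 2)%R).
assert (HM0 : (0 <= M)%R).
{ eapply Rle_trans; [apply Cmod_ge_0 | apply (HM t0 y0); auto].
  - replace (t0 - t0)%R with 0%R by ring; now rewrite Rabs_R0.
  - replace (y0 - y0) with (RtoC 0) by ring; now rewrite Cmod_0. }
assert (K1 : (0 <= 2 * M / e)%R).
{ apply Rmult_le_pos; [lra | left; apply Rinv_0_lt_compat; unfold e; lra]. }
assert (K2 : (0 <= 4 * M / e ^ 2)%R).
{ apply Rmult_le_pos; [lra | left; apply Rinv_0_lt_compat, pow_lt; unfold e; lra]. }
exists e, (2 * M / e + 4 * M / e ^ 2)%R; split; [unfold e; lra | split; [lra |]].
intros s y Hs Hst Hy.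
assert (Hin : forall p, (Cmod (p - y) <= e)%R -> (Cmod (p - y0) < eta)%R).
{ intros p Hp; replace (p - y0) with (p - y + (y - y0)) by ring.
  eapply Rle_lt_trans; [apply Cmod_triangle | unfold e in *; lra]. }
assert (Hst' : (Rabs (s - t0) < eta)%R) by (unfold e in *; lra).
destruct (cauchy_taylor (F s) y e M) as (c & Hc & HT).
- unfold e; lra.
- intros p Hp n; apply analytic_expands with half_plane.
  + now apply (pde_analytic _ _ HF).
  + now apply (HM s p Hs Hst' (Hin p Hp)).
- intros p Hp; now apply (HM s p Hs Hst' (Hin p Hp)).
- assert (Hyp : half_plane y) by (apply (HM s y Hs Hst'); unfold e in *; lra).
  destruct (pde_equation _ _ HF s y Hs Hyp) as (dt & dy & Hdt & Hdy & Heq).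
  exists c, dt; split; [lra | split; [| split]].
  + intros p Hp; eapply Rle_trans; [now apply HT |].
    apply Rmult_le_compat_r; [apply pow2_ge_0 | lra].
  + now apply time_derive_cderiv.
  + assert (Edy : dy = 2 * F s y * c).
    { apply (square_derive_unique (F s) y c dy e (4 * M / e ^ 2)); [| exact HT | exact Hdy].
      unfold e; lra. }
    replace dt with (dt + / 4 * (y ^ 2 - 1) * dy - / 4 * (y ^ 2 - 1) * dy) by ring.
    rewrite Heq, Edy.
    field.
Qed.

Lemma cderiv_lipschitz (D : R -> Prop) (f : R -> C) (t : R) (l : C) :
  cderiv D f t l ->
  exists d : R, (0 < d)%R /\ forall s, D s -> (Rabs (s - t) < d)%R ->
    (Cmod (f s - f t) <= (Cmod l + 1) * Rabs (s - t))%R.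
Proof.
intros H; destruct (H 1%R Rlt_0_1) as (d & Hd & Hf).
exists d; split; [exact Hd |]; intros s Hs Hst.
specialize (Hf s Hs Hst).
replace (f s - f t) with (f s - f t - RtoC (s - t) * l + RtoC (s - t) * l) by ring.
eapply Rle_trans; [apply Cmod_triangle |].
rewrite Cmod_mult, Cmod_R; lra.
Qed.

Lemma cderiv_continuous (D : R -> Prop) (f : R -> C) (t : R) (l : C) :
  cderiv D f t l -> forall eps, (0 < eps)%R ->
  exists d : R, (0 < d)%R /\ forall s, D s -> (Rabs (s - t) < d)%R ->
    (Cmod (f s - f t) < eps)%R.
Proof.
intros H eps He; destruct (cderiv_lipschitz _ _ _ _ H) as (d & Hd & Hf).
assert (Hl := Cmod_ge_0 l).
exists (Rmin d (eps / (Cmod l + 1))); split.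
{ apply Rmin_glb_lt; [exact Hd | apply Rdiv_lt_0_compat; lra]. }
intros s Hs Hst.
eapply Rle_lt_trans.
{ apply Hf; [exact Hs | apply Rlt_le_trans with (1 := Hst), Rmin_l]. }
assert (Hst2 := Rlt_le_trans _ _ _ Hst (Rmin_r _ _)).
replace eps with ((Cmod l + 1) * (eps / (Cmod l + 1)))%R by (field; lra).
apply Rmult_lt_compat_l; lra.
Qed.

(** The increment splits into a spatial Taylor error at time [u], the term [cu * (phi u - y)], and
    the time increment at the fixed point [y = phi s]. The delicate point is to replace [cu] by [c];
    it rests on the remainder constant [K] being common to all times [u]. *)
Lemma chain_rule (f : R -> C -> C) (phi : R -> C) (s eta K : R) (c dt l : C) :
  (0 < eta)%R -> (0 <= K)%R ->
  (forall u, time_domain u -> (Rabs (u - s) < eta)%R -> exists cu : C,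
     forall p, (Cmod (p - phi s) <= eta)%R ->
     (Cmod (f u p - f u (phi s) - cu * (p - phi s)) <= K * Cmod (p - phi s) ^ 2)%R) ->
  (forall p, (Cmod (p - phi s) <= eta)%R ->
     (Cmod (f s p - f s (phi s) - c * (p - phi s)) <= K * Cmod (p - phi s) ^ 2)%R) ->
  (forall p, (Cmod (p - phi s) < eta)%R -> exists dp, cderiv time_domain (fun u => f u p) s dp) ->
  cderiv time_domain (fun u => f u (phi s)) s dt ->
  cderiv (fun _ => True) phi s l ->
  cderiv time_domain (fun u => f u (phi u)) s (dt + c * l).
Proof.
intros Heta HK Hu Hc Hp Hdt Hl eps Heps.
set (y := phi s) in *.
pose (Lam := (Cmod l + 1)%R).
assert (HLam : (0 < Lam)%R) by (unfold Lam; assert (H := Cmod_ge_0 l); lra).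
assert (Hc0 := Cmod_ge_0 c).
(* [e1] is chosen so that [|cu - c| <= 2 * e1] and [|phi u - y| <= Lam * |u - s|] together cost a
   quarter of [eps]. The increment [x] is fixed before [u], with the two Taylor errors at [y + x]
   adding up to at most [e1 * x]. *)
pose (e1 := (eps / (8 * Lam))%R).
assert (He1 : (0 < e1)%R) by (unfold e1; apply Rdiv_lt_0_compat; lra).
pose (x := Rmin (eta / 2) (e1 / (2 * (K + 1)))).
assert (Hx : (0 < x)%R) by (apply Rmin_glb_lt; [lra | apply Rdiv_lt_0_compat; lra]).
assert (Hxe : (x < eta)%R).
{ apply Rle_lt_trans with (eta / 2)%R; [apply Rmin_l | lra]. }
assert (HxK : (2 * K * x <= e1)%R).
{ apply Rle_trans with (2 * (K + 1) * (e1 / (2 * (K + 1))))%R.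
  - apply Rmult_le_compat; try lra; apply Rmin_r.
  - right; field; lra. }
assert (Mx : Cmod (y + RtoC x - y) = x).
{ replace (y + RtoC x - y) with (RtoC x) by ring; rewrite Cmod_R, Rabs_right; lra. }
destruct (Hp (y + RtoC x) ltac:(lra)) as (dp & Hdp).
assert (He2 : (0 < e1 * x / 2)%R) by (apply Rdiv_lt_0_compat; [nra | lra]).
destruct (cderiv_continuous _ _ _ _ Hdp _ He2) as (d1 & Hd1 & Hcont1).
destruct (cderiv_continuous _ _ _ _ Hdt _ He2) as (d2 & Hd2 & Hcont2).
destruct (cderiv_lipschitz _ _ _ _ Hl) as (d3 & Hd3 & Hlip); fold Lam y in Hlip.
assert (He3 : (0 < eps / (4 * (Cmod c + 1)))%R) by (apply Rdiv_lt_0_compat; lra).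
destruct (Hl _ He3) as (d4 & Hd4 & Hphi); fold y in Hphi.
destruct (Hdt (eps / 4)%R ltac:(lra)) as (d5 & Hd5 & Ht).
pose (KL := (K * Lam ^ 2 + 1)%R).
assert (HKL : (0 < KL)%R).
{ assert (0 <= K * Lam ^ 2)%R by (apply Rmult_le_pos; [lra | apply pow2_ge_0]).
  unfold KL; lra. }
exists (Rmin (Rmin d1 d2) (Rmin (Rmin d3 d4) (Rmin (Rmin d5 eta)
          (Rmin (eta / Lam) (eps / (4 * KL)))))).
split.
{ repeat apply Rmin_glb_lt; try lra; apply Rdiv_lt_0_compat; lra. }
intros u Hnu Hus.
apply Rmin_Rgt_l in Hus; destruct Hus as (Hus1 & Hus2).
apply Rmin_Rgt_l in Hus1; destruct Hus1 as (Hu1 & Hu2).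
apply Rmin_Rgt_l in Hus2; destruct Hus2 as (Hus3 & Hus4).
apply Rmin_Rgt_l in Hus3; destruct Hus3 as (Hu3 & Hu4).
apply Rmin_Rgt_l in Hus4; destruct Hus4 as (Hus5 & Hus6).
apply Rmin_Rgt_l in Hus5; destruct Hus5 as (Hu5 & Hu6).
apply Rmin_Rgt_l in Hus6; destruct Hus6 as (Hu7 & Hu8).
apply Rgt_lt in Hu1; apply Rgt_lt in Hu2; apply Rgt_lt in Hu3; apply Rgt_lt in Hu4.
apply Rgt_lt in Hu5; apply Rgt_lt in Hu6; apply Rgt_lt in Hu7; apply Rgt_lt in Hu8.
specialize (Hcont1 u Hnu Hu1); specialize (Hcont2 u Hnu Hu2).
specialize (Hlip u I Hu3); specialize (Hphi u I Hu4); specialize (Ht u Hnu Hu5).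
destruct (Hu u Hnu Hu6) as (cu & Hcu).
set (r := Rabs (u - s)) in *.
assert (Hr : (0 <= r)%R) by apply Rabs_pos.
set (D := phi u - y) in *.
assert (HD : (Cmod D <= eta)%R).
{ eapply Rle_trans; [exact Hlip |].
  apply Rle_trans with (Lam * (eta / Lam))%R; [apply Rmult_le_compat_l; lra |].
  right; field; lra. }
(* the coefficient [c] depends continuously on time, as it is approximated
   uniformly by the difference quotient with increment [x] *)
assert (Hcc : (Cmod (cu - c) <= 2 * e1)%R).
{ assert (T1 := Hcu (y + RtoC x) ltac:(lra)).
  assert (T2 := Hc (y + RtoC x) ltac:(lra)).
  rewrite Mx in T1, T2; replace (y + RtoC x - y) with (RtoC x) in T1, T2 by ring.
  set (A1 := f u (y + RtoC x) - f u y - cu * RtoC x) in *.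
  set (A2 := f s (y + RtoC x) - f s y - c * RtoC x) in *.
  set (A3 := f u (y + RtoC x) - f s (y + RtoC x)) in *.
  set (A4 := f u y - f s y) in *.
  assert (E : RtoC x * (cu - c) = - A1 + A2 + A3 + - A4)
    by (unfold A1, A2, A3, A4; ring).
  assert (B1 := Cmod_triangle (- A1 + A2 + A3) (- A4)).
  assert (B2 := Cmod_triangle (- A1 + A2) A3).
  assert (B3 := Cmod_triangle (- A1) A2).
  rewrite Cmod_opp in B1, B3.
  apply Rmult_le_reg_l with x; [exact Hx |].
  replace (x * Cmod (cu - c))%R with (Cmod (RtoC x * (cu - c)))
    by (rewrite Cmod_mult, Cmod_R, (Rabs_right x) by lra; ring).
  rewrite E.
  assert (2 * K * x ^ 2 <= e1 * x)%R by nra.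
  nra. }
assert (HDc : phi u = y + D) by (unfold D; ring).
specialize (Hcu (phi u) HD); fold D in Hcu.
set (A1 := f u (phi u) - f u y - cu * D) in *.
set (A2 := D - RtoC (u - s) * l) in *.
set (A3 := f u y - f s y - RtoC (u - s) * dt) in *.
replace (f u (phi u) - f s y - RtoC (u - s) * (dt + c * l))
  with (A1 + (cu - c) * D + c * A2 + A3)
  by (unfold A1, A2, A3; ring).
assert (B1 := Cmod_triangle (A1 + (cu - c) * D + c * A2) A3).
assert (B2 := Cmod_triangle (A1 + (cu - c) * D) (c * A2)).
assert (B3 := Cmod_triangle A1 ((cu - c) * D)).
rewrite Cmod_mult in B2; rewrite Cmod_mult in B3.
assert (S1 : (Cmod A1 <= eps / 4 * r)%R).
{ eapply Rle_trans; [exact Hcu |].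
  assert (Cmod D ^ 2 <= (Lam * r) ^ 2)%R
    by (apply pow_incr; split; [apply Cmod_ge_0 | exact Hlip]).
  assert (Hk : (KL * r <= eps / 4)%R).
  { apply Rle_trans with (KL * (eps / (4 * KL)))%R; [apply Rmult_le_compat_l; lra |].
    right; field; lra. }
  apply Rle_trans with (K * (Lam * r) ^ 2)%R; [apply Rmult_le_compat_l; lra |].
  apply Rle_trans with (KL * r * r)%R; [| apply Rmult_le_compat_r; lra].
  unfold KL; nra. }
assert (S2 : (Cmod (cu - c) * Cmod D <= eps / 4 * r)%R).
{ apply Rle_trans with (2 * e1 * (Lam * r))%R.
  - apply Rmult_le_compat; try apply Cmod_ge_0; assumption.
  - right; unfold e1; field; lra. }
assert (S3 : (Cmod c * Cmod A2 <= eps / 4 * r)%R).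
{ apply Rle_trans with ((Cmod c + 1) * (eps / (4 * (Cmod c + 1)) * r))%R.
  - apply Rmult_le_compat; try apply Cmod_ge_0; lra.
  - right; field; lra. }
lra.
Qed.

(** The bound [K] on both [c] and the curve holds for all [s] near [t0]; it supplies the local
    Gronwall constant. *)
Lemma pde_along_curve (kappa : R) (F : R -> C -> C) (phi : R -> C) (t0 : R) :
  pde_solution kappa F -> (0 <= t0)%R -> half_plane (phi t0) ->
  (exists l, cderiv (fun _ => True) phi t0 l) ->
  exists eta K : R, (0 < eta)%R /\ (0 <= K)%R /\
    forall s l, (0 <= s)%R -> (Rabs (s - t0) < eta)%R ->
      cderiv (fun _ => True) phi s l ->
      exists c : C, (Cmod c <= K)%R /\ (Cmod (phi s) <= K)%R /\
        cderiv time_domain (fun u => F u (phi u)) s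
          (kappa ^ 2 / 2 * phi s * (phi s ^ 2 - 1)
           - (phi s ^ 2 - 1) / 2 * F s (phi s) * c + c * l).
Proof.
intros HF Ht0 Hy0 (l0 & Hl0).
destruct (pde_local kappa F t0 (phi t0) HF Ht0 Hy0) as (eta & K & Heta & HK & Hloc).
destruct (cderiv_continuous _ _ _ _ Hl0 (Rmin 1 (eta / 2))%R) as (d & Hd & Hcont).
{ apply Rmin_glb_lt; lra. }
exists (Rmin d (eta / 2)), (Rmax K (Cmod (phi t0) + 1)).
split; [apply Rmin_glb_lt; lra | split].
{ eapply Rle_trans; [exact HK | apply Rmax_l]. }
intros s l Hs Hst Hl.
assert (Hst1 := Rlt_le_trans _ _ _ Hst (Rmin_l _ _)).
assert (Hst2 := Rlt_le_trans _ _ _ Hst (Rmin_r _ _)).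
specialize (Hcont s I Hst1).
assert (Hc1 := Rlt_le_trans _ _ _ Hcont (Rmin_l _ _)).
assert (Hc2 := Rlt_le_trans _ _ _ Hcont (Rmin_r _ _)).
destruct (Hloc s (phi s) Hs ltac:(lra) ltac:(lra)) as (c & dt & Hc & HT & Hdt & Edt).
exists c; split; [| split].
- eapply Rle_trans; [exact Hc | apply Rmax_l].
- eapply Rle_trans; [| apply Rmax_r].
  assert (Ht := Cmod_triangle (phi s - phi t0) (phi t0)).
  replace (phi s - phi t0 + phi t0) with (phi s) in Ht by ring; lra.
- rewrite <- Edt.
  apply chain_rule with (eta := (eta / 2)%R) (K := K); auto; try lra.
  + intros u Hu Hus.
    assert (Hut : (Rabs (u - t0) < eta)%R).
    { replace (u - t0)%R with (u - s + (s - t0))%R by ring.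
      eapply Rle_lt_trans; [apply Rabs_triang | lra]. }
    destruct (Hloc u (phi s) Hu Hut ltac:(lra)) as (cu & dtu & _ & HTu & _).
    exists cu; intros p Hp; apply HTu; lra.
  + intros p Hp; apply HT; lra.
  + intros p Hp.
    assert (Hp0 : (Cmod (p - phi t0) < eta)%R).
    { replace (p - phi t0) with (p - phi s + (phi s - phi t0)) by ring.
      eapply Rle_lt_trans; [apply Cmod_triangle | lra]. }
    destruct (Hloc s p Hs ltac:(lra) Hp0) as (_ & dp & _ & _ & Hdp & _).
    now exists dp.
Qed.

(** * Gronwall's inequality *)

Lemma cderiv_components (f : R -> C) (t d : R) (l : C) :
  (0 < d)%R ->
  cderiv (fun s => (Rabs (s - t) < d)%R) f t l ->
  is_derive (fun s => fst (f s)) t (fst l) /\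
  is_derive (fun s => snd (f s)) t (snd l).
Proof.
intros Hd Hf.
assert (Hgen : forall (proj : C -> R) , (forall z, (Rabs (proj z) <= Cmod z)%R) ->
  (forall z w (r : R), proj (z - w - RtoC r * l) = (proj z - proj w - r * proj l)%R) ->
  is_derive (fun s => proj (f s)) t (proj l)).
{ intros proj Hp Hlin; apply is_derive_Reals; intros eps He.
  destruct (Hf (eps / 2)%R ltac:(lra)) as (e & Hpe & H).
  assert (Hm : (0 < Rmin d e)%R) by now apply Rmin_glb_lt.
  exists (mkposreal _ Hm); intros h Hh0 Hh; simpl in Hh.
  specialize (H (t + h)%R).
  replace (t + h - t)%R with h in H by ring.
  specialize (H (Rlt_le_trans _ _ _ Hh (Rmin_l _ _)) (Rlt_le_trans _ _ _ Hh (Rmin_r _ _))).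
  eapply Rle_trans in H; [| apply Hp].
  rewrite Hlin in H.
  assert (Hah := Rabs_pos_lt h Hh0).
  apply Rmult_lt_reg_r with (Rabs h); [exact Hah |].
  rewrite <- Rabs_mult.
  replace (((proj (f (t + h)%R) - proj (f t)) / h - proj l) * h)%R
    with (proj (f (t + h)%R) - proj (f t) - h * proj l)%R by (field; exact Hh0).
  nra. }
split; apply Hgen.
- exact re_le_Cmod.
- intros [z1 z2] [w1 w2] r; destruct l; simpl; ring.
- exact im_le_Cmod.
- intros [z1 z2] [w1 w2] r; destruct l; simpl; ring.
Qed.

Lemma continuity_pt_of_Cmod (U : R -> C) (x : R) :
  (forall eps, (0 < eps)%R -> exists d, (0 < d)%R /\ forall s, (Rabs (s - x) < d)%R ->
     (Cmod (U s - U x) < eps)%R) ->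
  continuity_pt (fun s => fst (U s)) x /\ continuity_pt (fun s => snd (U s)) x.
Proof.
intros H; split; intros eps He; destruct (H eps He) as (d & Hd & Hs);
  exists d; (split; [exact Hd |]); intros s (_ & Hsx);
  apply Rle_lt_trans with (2 := Hs s Hsx).
- apply (re_le_Cmod (U s - U x)).
- apply (im_le_Cmod (U s - U x)).
Qed.

(** The function [exp (- 2 L x) |u|^2] is nonincreasing, because by Cauchy-Schwarz the derivative of
    [|u|^2] is at most [2 L |u|^2]. *)
Lemma gronwall_interval (u : R -> C) (a b L : R) :
  (0 <= a)%R -> (a <= b)%R ->
  (forall s, (a <= s <= b)%R -> exists d, (Cmod d <= L * Cmod (u s))%R /\ cderiv time_domain u s d) ->
  u a = 0 -> u b = 0.
Proof.
intros Ha Hab Hu Hua.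
destruct (Rle_lt_or_eq_dec _ _ Hab) as [Hlt | <-]; [| exact Hua].
(* Clamping the argument to [[a, b]] extends [u] continuously to the whole line, which turns
   one-sided continuity at the endpoints into the two-sided [continuity_pt]. *)
pose (k := fun x => Rmax a (Rmin b x)).
assert (Hk : forall x, (a <= k x <= b)%R).
{ intros x; split; [apply Rmax_l |].
  apply Rmax_lub; [exact Hab | apply Rmin_l]. }
assert (Hkid : forall x, (a <= x <= b)%R -> k x = x).
{ intros x Hx; unfold k; rewrite Rmin_right by lra; apply Rmax_right; lra. }
assert (Hklip : forall x z, (Rabs (k x - k z) <= Rabs (x - z))%R).
{ intros x z; unfold k, Rmax, Rmin.
  repeat destruct Rle_dec; unfold Rabs; repeat destruct Rcase_abs; lra. }
pose (U := fun x => u (k x)).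
assert (HUc : forall x, continuity_pt (fun s => fst (U s)) x /\ continuity_pt (fun s => snd (U s)) x).
{ intros x; apply continuity_pt_of_Cmod; intros eps He.
  destruct (Hu (k x) (Hk x)) as (d & _ & Hd).
  destruct (cderiv_continuous _ _ _ _ Hd eps He) as (e & Hpe & H).
  exists e; split; [exact Hpe |]; intros s Hs; apply H.
  - unfold time_domain; specialize (Hk s); lra.
  - eapply Rle_lt_trans; [apply Hklip | exact Hs]. }
pose (v := fun x => (exp (- (2 * L) * x) * (fst (U x) * fst (U x) + snd (U x) * snd (U x)))%R).
assert (Hder : forall x, (a < x < b)%R -> exists d, (d <= 0)%R /\ is_derive v x d).
{ intros x Hx.
  destruct (Hu x ltac:(lra)) as (d & Hd & Hud).
  pose (e := Rmin (x - a) (b - x)).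
  assert (He : (0 < e)%R) by (apply Rmin_glb_lt; lra).
  assert (Hin : forall s, (Rabs (s - x) < e)%R -> (a <= s <= b)%R).
  { intros s Hs; assert (H1 := Rlt_le_trans _ _ _ Hs (Rmin_l _ _)).
    assert (H2 := Rlt_le_trans _ _ _ Hs (Rmin_r _ _)).
    apply Rabs_def2 in H1; apply Rabs_def2 in H2; lra. }
  assert (HUd : cderiv (fun s => (Rabs (s - x) < e)%R) U x d).
  { intros eps Heps; destruct (Hud eps Heps) as (d0 & Hd0 & H).
    exists d0; split; [exact Hd0 |]; intros s Hs1 Hs2.
    unfold U; rewrite !Hkid by (try lra; now apply Hin).
    apply H; [| exact Hs2].
    unfold time_domain; specialize (Hin s Hs1); lra. }
  destruct (cderiv_components U x e d He HUd) as (D1 & D2).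
  assert (HUx : U x = u x) by (unfold U; rewrite Hkid by lra; reflexivity).
  rewrite <- HUx in Hd.
  set (p := fst (U x)) in *; set (q := snd (U x)) in *.
  exists (exp (- (2 * L) * x) * (2 * (p * fst d + q * snd d) - 2 * L * (p * p + q * q)))%R.
  split.
  - assert (He0 := exp_pos (- (2 * L) * x)).
    assert (Hsq : (Cmod (U x) ^ 2 = p * p + q * q)%R)
      by (rewrite Cmod2_alt; unfold Re, Im; fold p q; ring).
    assert (Hcs : (p * fst d + q * snd d <= Cmod (U x) * Cmod d)%R).
    { apply Rle_trans with (1 := Rle_abs _).
      replace (p * fst d + q * snd d)%R with (Re (U x * Cconj d))
        by (unfold Re; simpl; fold p q; ring).
      eapply Rle_trans; [apply re_le_Cmod |].
      rewrite Cmod_mult, Cmod_conj; lra. }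
    assert (HU0 := Cmod_ge_0 (U x)).
    assert (Cmod (U x) * Cmod d <= L * Cmod (U x) ^ 2)%R by nra.
    replace 0%R with (exp (- (2 * L) * x) * 0)%R by ring.
    apply Rmult_le_compat_l; [lra | rewrite <- Hsq; lra].
  - unfold v; evar_last.
    + apply (is_derive_mult (K := R_AbsRing) (fun y => exp (- (2 * L) * y))
        (fun y => fst (U y) * fst (U y) + snd (U y) * snd (U y))%R).
      * auto_derive; [trivial | reflexivity].
      * apply (is_derive_plus (K := R_AbsRing) (V := R_NormedModule)).
        -- apply (is_derive_mult (K := R_AbsRing) (fun y => fst (U y)) (fun y => fst (U y)));
             [exact D1 | exact D1 | apply Rmult_comm].
        -- apply (is_derive_mult (K := R_AbsRing) (fun y => snd (U y)) (fun y => snd (U y)));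
             [exact D2 | exact D2 | apply Rmult_comm].
      * apply Rmult_comm.
    + unfold plus, mult; simpl; fold p q; ring. }
(* The mean value point may be an endpoint, where [v] need not be differentiable; the default 0
   keeps the sign there. *)
pose (df := fun x => if Rlt_dec a x then if Rlt_dec x b then Derive v x else 0%R else 0%R).
assert (Hdf : forall x, (df x <= 0)%R).
{ intros x; unfold df.
  destruct (Rlt_dec a x); [destruct (Rlt_dec x b) |]; try lra.
  destruct (Hder x) as (d & Hd0 & Hd); [lra |].
  now rewrite (is_derive_unique _ _ _ Hd). }
assert (Hv : (v b <= v a)%R).
{ destruct (MVT_gen v a b df) as (c & Hc & E).
  - rewrite Rmin_left, Rmax_right by lra; intros x Hx.
    unfold df; destruct (Rlt_dec a x); [destruct (Rlt_dec x b) |]; try lra.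
    destruct (Hder x Hx) as (d & _ & Hd); apply Derive_correct; now exists d.
  - intros x _; destruct (HUc x) as (C1 & C2); unfold v.
    apply (continuity_pt_mult (fun y => exp (- (2 * L) * y))
             (fun y => fst (U y) * fst (U y) + snd (U y) * snd (U y))%R).
    + apply continuity_pt_filterlim.
      apply (ex_derive_continuous (K := R_AbsRing) (V := R_NormedModule)
               (fun y => exp (- (2 * L) * y))).
      auto_derive; trivial.
    + apply (continuity_pt_plus (fun y => fst (U y) * fst (U y))%R
               (fun y => snd (U y) * snd (U y))%R);
        apply continuity_pt_mult; assumption.
  - specialize (Hdf c); nra. }
unfold v, U in Hv; rewrite !Hkid, Hua in Hv by lra; simpl in Hv.
rewrite (Rmult_0_l 0), Rplus_0_r, Rmult_0_r in Hv.
assert (He := exp_pos (- (2 * L) * b)).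
assert (Hz : (fst (u b) * fst (u b) + snd (u b) * snd (u b) <= 0)%R).
{ apply Rmult_le_reg_l with (exp (- (2 * L) * b)); [exact He | lra]. }
apply injective_projections; simpl; nra.
Qed.

(** The constant [L] is only local, so the supremum [m] of the times up to which [u] vanishes is
    considered: the constant valid near [m] pushes the zeros past [m], unless [m = T]. *)
Lemma gronwall_zero (u : R -> C) (T : R) :
  (0 <= T)%R ->
  (forall m, (0 <= m <= T)%R -> exists eta L : R, (0 < eta)%R /\
     forall s, (0 <= s <= T)%R -> (Rabs (s - m) < eta)%R ->
     exists d, (Cmod d <= L * Cmod (u s))%R /\ cderiv time_domain u s d) ->
  u 0%R = 0 -> u T = 0.
Proof.
intros HT Hloc Hu0.
pose (E := fun s => (0 <= s <= T)%R /\ forall x, (0 <= x <= s)%R -> u x = 0).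
assert (HE0 : E 0%R).
{ split; [lra |]; intros x Hx; now replace x with 0%R by lra. }
destruct (completeness E) as (m & Hub & Hlub).
- exists T; intros s (Hs & _); lra.
- now exists 0%R.
- assert (Hm : (0 <= m <= T)%R).
  { split; [now apply Hub |]; apply Hlub; intros s (Hs & _); lra. }
  destruct (Hloc m Hm) as (eta & L & Heta & Hd).
  assert (Hs1 : exists s1, E s1 /\ (m - eta < s1)%R).
  { apply NNPP; intros Hno.
    assert (m <= m - eta)%R; [| lra].
    apply Hlub; intros s Hs; apply Rnot_lt_le; intros Hlt; apply Hno; now exists s. }
  destruct Hs1 as (s1 & (Hs1 & Hz) & Hs1m).
  assert (Hs1m' : (s1 <= m)%R) by (apply Hub; split; assumption).
  assert (HEm : E (Rmin T (m + eta / 2))).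
  { assert (M1 := Rmin_l T (m + eta / 2)); assert (M2 := Rmin_r T (m + eta / 2)).
    split.
    - split; [apply Rmin_glb; lra | exact M1].
    - intros x Hx; destruct (Rle_dec x s1) as [Hxs | Hxs]; [apply Hz; lra |].
      apply (gronwall_interval u s1 x L); [lra | lra | | apply Hz; lra].
      intros s Hs; apply Hd; [lra | apply Rabs_def1; lra]. }
  assert (Hle := Hub _ HEm).
  assert (HTm : (T <= m)%R).
  { unfold Rmin in Hle; destruct Rle_dec; lra. }
  apply (proj2 HEm); split; [lra | apply Rmin_glb; lra].
Qed.

(** * The explicit flow *)

Definition all_times (s : R) : Prop := True.

Lemma cderiv_weaken (D D' : R -> Prop) (f : R -> C) (t : R) (l : C) :
  (forall s, D' s -> D s) -> cderiv D f t l -> cderiv D' f t l.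
Proof.
intros HD H eps He; destruct (H eps He) as (d & Hd & Hf).
exists d; auto.
Qed.

(** Lets the product, inverse and exponential rules be taken from real calculus. *)
Lemma cderiv_iff_components (f : R -> C) (t : R) (l : C) :
  cderiv all_times f t l <->
  is_derive (fun s => fst (f s)) t (fst l) /\
  is_derive (fun s => snd (f s)) t (snd l).
Proof.
split.
- intros H; apply cderiv_components with 1%R; [lra |].
  apply (cderiv_weaken all_times); [easy | exact H].
- intros (H1 & H2) eps He.
  apply is_derive_Reals in H1; apply is_derive_Reals in H2.
  destruct (H1 (eps / 2)%R ltac:(lra)) as (d1 & Hd1).
  destruct (H2 (eps / 2)%R ltac:(lra)) as (d2 & Hd2).
  exists (Rmin d1 d2); split; [apply Rmin_glb_lt; apply cond_pos |].
  intros s _ Hs.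
  destruct (Req_dec s t) as [-> | Hn].
  { replace (f t - f t - RtoC (t - t) * l) with (RtoC 0)
      by (replace (t - t)%R with 0%R by ring; ring).
    rewrite Cmod_0, Rminus_diag, Rabs_R0; lra. }
  assert (Hn' : (s - t <> 0)%R) by lra.
  specialize (Hd1 (s - t)%R Hn' (Rlt_le_trans _ _ _ Hs (Rmin_l _ _))).
  specialize (Hd2 (s - t)%R Hn' (Rlt_le_trans _ _ _ Hs (Rmin_r _ _))).
  replace (t + (s - t))%R with s in Hd1, Hd2 by ring.
  assert (Hp := Rabs_pos_lt _ Hn').
  assert (Hc : forall x y m : R, (Rabs ((x - y) / (s - t) - m) < eps / 2)%R ->
    (Rabs (x - y - (s - t) * m) <= eps / 2 * Rabs (s - t))%R).
  { intros x y m H.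
    replace (x - y - (s - t) * m)%R with (((x - y) / (s - t) - m) * (s - t))%R
      by (field; exact Hn').
    rewrite Rabs_mult; apply Rmult_le_compat_r; lra. }
  apply Hc in Hd1; apply Hc in Hd2.
  eapply Rle_trans; [apply Cmod_le_abs_sum |].
  replace (Re (f s - f t - RtoC (s - t) * l))
    with (fst (f s) - fst (f t) - (s - t) * fst l)%R by (simpl; ring).
  replace (Im (f s - f t - RtoC (s - t) * l))
    with (snd (f s) - snd (f t) - (s - t) * snd l)%R by (simpl; ring).
  lra.
Qed.

Lemma cderiv_const (a : C) (t : R) : cderiv all_times (fun _ => a) t 0.
Proof.
apply cderiv_iff_components; split; apply (is_derive_const (K := R_AbsRing) (V := R_NormedModule)).
Qed.

Lemma cderiv_plus (D : R -> Prop) (f g : R -> C) (t : R) (l m : C) :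
  cderiv D f t l -> cderiv D g t m -> cderiv D (fun s => f s + g s) t (l + m).
Proof.
intros Hf Hg eps He.
destruct (Hf (eps / 2)%R ltac:(lra)) as (d & Hd & H1).
destruct (Hg (eps / 2)%R ltac:(lra)) as (e & Hpe & H2).
exists (Rmin d e); split; [now apply Rmin_glb_lt |].
intros s Hs Hst.
specialize (H1 s Hs (Rlt_le_trans _ _ _ Hst (Rmin_l _ _))).
specialize (H2 s Hs (Rlt_le_trans _ _ _ Hst (Rmin_r _ _))).
replace (f s + g s - (f t + g t) - RtoC (s - t) * (l + m))
  with ((f s - f t - RtoC (s - t) * l) + (g s - g t - RtoC (s - t) * m)) by ring.
eapply Rle_trans; [apply Cmod_triangle | lra].
Qed.

Lemma is_derive_Rmult (f g : R -> R) (t l m : R) :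
  is_derive f t l -> is_derive g t m ->
  is_derive (fun s => (f s * g s)%R) t (l * g t + f t * m)%R.
Proof.
intros H1 H2; apply (is_derive_mult (K := R_AbsRing) f g); auto; apply Rmult_comm.
Qed.

Lemma cderiv_mult (f g : R -> C) (t : R) (l m : C) :
  cderiv all_times f t l -> cderiv all_times g t m ->
  cderiv all_times (fun s => f s * g s) t (l * g t + f t * m).
Proof.
rewrite !cderiv_iff_components; intros (H1 & H2) (H3 & H4); split; evar_last.
- apply (is_derive_minus (K := R_AbsRing) (V := R_NormedModule));
    apply is_derive_Rmult; eassumption.
- unfold minus, plus, opp; simpl; ring.
- apply (is_derive_plus (K := R_AbsRing) (V := R_NormedModule));
    apply is_derive_Rmult; eassumption.
- unfold plus; simpl; ring.
Qed.

Lemma cderiv_inv (f : R -> C) (t : R) (l : C) :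
  f t <> 0 -> cderiv all_times f t l ->
  cderiv all_times (fun s => / f s) t (- l * (/ f t * / f t)).
Proof.
rewrite !cderiv_iff_components; intros Hn (H1 & H2).
assert (Hq : (fst (f t) ^ 2 + snd (f t) ^ 2 <> 0)%R).
{ intros E; apply Hn; apply injective_projections; simpl; nra. }
assert (Hd : is_derive (fun s => (fst (f s) ^ 2 + snd (f s) ^ 2)%R) t
   (2 * (fst (f t) * fst l + snd (f t) * snd l))%R).
{ evar_last.
  - apply (is_derive_plus (K := R_AbsRing) (V := R_NormedModule));
      apply is_derive_pow; eassumption.
  - unfold plus; simpl; ring. }
split; evar_last.
- apply is_derive_div; [exact H1 | exact Hd | exact Hq].
- simpl in *; field; now rewrite !Rmult_1_r in Hq.
- apply is_derive_div; [| exact Hd | exact Hq].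
  apply (is_derive_opp (K := R_AbsRing) (V := R_NormedModule)); exact H2.
- unfold opp; simpl in *; field; now rewrite !Rmult_1_r in Hq.
Qed.

Lemma cderiv_exp (r : C) (t : R) :
  cderiv all_times (fun s => Cexp (r * RtoC s)) t (r * Cexp (r * RtoC t)).
Proof.
apply cderiv_iff_components; destruct r as [r1 r2]; unfold Cexp; simpl; split; auto_derive; trivial; unfold Rminus; ring.
Qed.

(** No prior continuity of the branch is used: principal roots have nonnegative real part, so
    [|w s + w t| >= rho > 0], and [(w s - w t) (w s + w t) = q s - q t] makes [w] Lipschitz at [t].
    The derivative follows from [2 w_t (w_s - w_t) = q_s - q_t - (w_s - w_t)^2], whose last term is
    of second order. *)
Lemma cderiv_sqrt (q : R -> C) (t : R) (l : C) :
  (0 < Re (Csqrt (q t)))%R -> cderiv all_times q t l ->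
  cderiv all_times (fun s => Csqrt (q s)) t (l / (2 * Csqrt (q t))).
Proof.
intros Hre Hq eps He.
set (w := fun s => Csqrt (q s)); change (Csqrt (q t)) with (w t) in *.
set (rho := Re (w t)) in *.
assert (Hw : forall s, w s ^ 2 = q s) by (intros s; apply Csqrt_sqr).
assert (Hrho : (rho <= Cmod (w t))%R)
  by (apply Rle_trans with (2 := re_le_Cmod _); apply Rle_abs).
assert (Hwt : w t <> 0) by (apply Cmod_gt_0; lra).
destruct (cderiv_lipschitz _ _ _ _ Hq) as (d1 & Hd1 & Hlip).
set (Lam := (Cmod l + 1)%R) in *.
assert (HLam : (0 < Lam)%R) by (unfold Lam; assert (H := Cmod_ge_0 l); lra).
assert (He1 : (0 < eps * rho)%R) by (apply Rmult_lt_0_compat; lra).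
destruct (Hq (eps * rho)%R He1) as (d2 & Hd2 & Hder).
pose (d3 := (eps * rho / (Lam / rho) ^ 2)%R).
assert (Hr2 : (0 < (Lam / rho) ^ 2)%R)
  by (apply pow_lt, Rdiv_lt_0_compat; lra).
exists (Rmin d1 (Rmin d2 d3)); split.
{ repeat apply Rmin_glb_lt; try assumption; now apply Rdiv_lt_0_compat. }
intros s _ Hs.
assert (Hs1 := Rlt_le_trans _ _ _ Hs (Rmin_l _ _)).
assert (Hs2 := Rlt_le_trans _ _ _ Hs (Rmin_r _ _)).
assert (Hs3 := Rlt_le_trans _ _ _ Hs2 (Rmin_l _ _)).
assert (Hs4 := Rlt_le_trans _ _ _ Hs2 (Rmin_r _ _)).
specialize (Hlip s I Hs1); specialize (Hder s I Hs3).
set (h := Rabs (s - t)) in *.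
assert (Hh : (0 <= h)%R) by apply Rabs_pos.
assert (Hsum : (rho <= Cmod (w s + w t))%R).
{ apply Rle_trans with (2 := re_le_Cmod _); apply Rle_trans with (2 := Rle_abs _).
  assert (H := proj1 (Csqrt_principal (q s))); fold (w s) in H.
  change (0 <= fst (w s))%R in H.
  change (fst (w t) <= fst (w s) + fst (w t))%R; lra. }
assert (Hww : (Cmod (w s - w t) <= Lam / rho * h)%R).
{ apply Rmult_le_reg_l with rho; [exact Hre |].
  replace (rho * (Lam / rho * h))%R with (Lam * h)%R by (field; lra).
  apply Rle_trans with (2 := Hlip).
  rewrite <- !Hw; replace (w s ^ 2 - w t ^ 2) with ((w s + w t) * (w s - w t)) by ring.
  rewrite Cmod_mult; apply Rmult_le_compat_r; [apply Cmod_ge_0 | exact Hsum]. }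
apply Rmult_le_reg_l with (2 * rho)%R; [lra |].
apply Rle_trans with (Cmod (2 * w t * (w s - w t - RtoC (s - t) * (l / (2 * w t))))).
{ rewrite (Cmod_mult (2 * w t)), (Cmod_mult 2), Cmod_R, (Rabs_right 2) by lra.
  apply Rmult_le_compat_r; [apply Cmod_ge_0 | lra]. }
replace (2 * w t * (w s - w t - RtoC (s - t) * (l / (2 * w t))))
  with (q s - q t - RtoC (s - t) * l + - (w s - w t) ^ 2)
  by (rewrite <- !Hw; field; exact Hwt).
eapply Rle_trans; [apply Cmod_triangle |].
rewrite Cmod_opp, Cmod_pow.
assert (Cmod (w s - w t) ^ 2 <= eps * rho * h)%R; [| lra].
apply Rle_trans with ((Lam / rho * h) ^ 2)%R.
- apply pow_incr; split; [apply Cmod_ge_0 | exact Hww].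
- rewrite Rpow_mult_distr.
  replace (eps * rho * h)%R with ((Lam / rho) ^ 2 * (d3 * h))%R
    by (unfold d3; field; lra).
  apply Rmult_le_compat_l; [lra |]; nra.
Qed.

Lemma cderiv_ext (D : R -> Prop) (f g : R -> C) (t : R) (l m : C) :
  (forall s, f s = g s) -> l = m -> cderiv D f t l -> cderiv D g t m.
Proof.
intros Efg <- H eps He; destruct (H eps He) as (d & Hd & Hf).
exists d; split; [exact Hd |]; intros s; rewrite <- !Efg; apply Hf.
Qed.

(** Here [r = sqrt a], [k = kappa^2], [q = phi^2] and [P = phi G]. The first derivative is
    [2 phi phi' = (phi^2 - 1) phi G], and the last relation is [G^2 = k q + (r^2 - k)] multiplied by
    [q]. With [E' = r E], each claim is a rational identity in [r], [k] and [E]. *)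
Lemma rational_curve (r k : C) (E : R -> C) (t : R) :
  cderiv all_times E t (r * E t) ->
  let N s := (r ^ 2 + k + E s) ^ 2 - 4 * k * r ^ 2 in
  let q s := 1 - 4 * r ^ 2 * E s / N s in
  let P s := r * ((r ^ 2 - k) ^ 2 - E s ^ 2) / N s in
  N t <> 0 ->
  cderiv all_times q t ((q t - 1) * P t) /\
  cderiv all_times P t ((q t - 1) / 2 * (2 * k * q t + (r ^ 2 - k))) /\
  P t ^ 2 = q t * (k * q t + (r ^ 2 - k)).
Proof.
intros HE N q P HN.
assert (HN' : cderiv all_times N t (2 * (r ^ 2 + k + E t) * (r * E t))).
{ assert (H0 := cderiv_plus all_times _ _ t _ _ (cderiv_const (r ^ 2 + k) t) HE).
  refine (cderiv_ext _ _ _ t _ _ _ _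
    (cderiv_plus all_times _ _ t _ _ (cderiv_mult _ _ t _ _ H0 H0)
                 (cderiv_const (- (4 * k * r ^ 2)) t))); intros; unfold N; ring. }
assert (HI := cderiv_inv N t _ HN HN').
split; [| split].
- refine (cderiv_ext _ _ _ t _ _ _ _
    (cderiv_plus all_times _ _ t _ _ (cderiv_const 1 t)
      (cderiv_mult _ _ t _ _ (cderiv_const (- (4 * r ^ 2)) t)
        (cderiv_mult _ _ t _ _ HE HI)))).
  + intros s; unfold q; unfold Cdiv; ring.
  + unfold N in HN; unfold q, P, N; field; exact HN.
- refine (cderiv_ext _ _ _ t _ _ _ _
    (cderiv_mult _ _ t _ _
      (cderiv_plus all_times _ _ t _ _ (cderiv_const (r * (r ^ 2 - k) ^ 2) t)
        (cderiv_mult _ _ t _ _ (cderiv_const (- r) t) (cderiv_mult _ _ t _ _ HE HE)))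
      HI)).
  + intros s; unfold P; unfold Cdiv; ring.
  + unfold N in HN; unfold q, P, N; field; exact HN.
- unfold N in HN; unfold q, P, N; field; exact HN.
Qed.

Lemma Csqrt_unique (z w : C) : w ^ 2 = z -> (0 < Re w)%R -> Csqrt z = w.
Proof.
intros E Hw.
assert (Hs := Csqrt_sqr z); assert (Hp := proj1 (Csqrt_principal z)).
set (v := Csqrt z) in *; clearbody v.
assert (Hn : v + w <> 0).
{ intros H; apply (f_equal Re) in H; unfold Re in *; simpl in H; lra. }
assert (H0 : (v - w) * (v + w) = 0)
  by (replace ((v - w) * (v + w)) with (v ^ 2 - w ^ 2) by ring; rewrite Hs, E; ring).
replace v with ((v - w) * (v + w) / (v + w) + w) by (field; exact Hn).
rewrite H0; field; exact Hn.
Qed.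

(* Solves [phi' = (phi^2 - 1) / 2 * flow_value], as the equation requires of
   the value of [F] along a characteristic. *)
Definition flow_value (kappa t : R) (y : C) : C :=
  Csqrt (flow_a kappa y)
  * ((flow_a kappa y - kappa ^ 2) ^ 2 - (flow_lambda kappa y * flow_exp kappa t y) ^ 2)
  / phi_den kappa t y * / phi kappa t y.

Lemma half_plane_neq_0 (y : C) : half_plane y -> y <> 0.
Proof. intros Hy ->; unfold half_plane in Hy; simpl in Hy; lra. Qed.

Lemma flow_characteristic (kappa t : R) (y : C) :
  phi_den kappa t y <> 0 -> half_plane (phi kappa t y) ->
  cderiv all_times (fun s => phi kappa s y) t
    ((phi kappa t y ^ 2 - 1) / 2 * flow_value kappa t y) /\
  cderiv all_times (fun s => flow_value kappa s y) t
    (kappa ^ 2 / 2 * phi kappa t y * (phi kappa t y ^ 2 - 1)) /\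
  flow_value kappa t y ^ 2
    = kappa ^ 2 * phi kappa t y ^ 2 + (1 - kappa ^ 2) * y ^ 2.
Proof.
intros HN Hphi.
pose (r := Csqrt (flow_a kappa y)).
assert (Hr : flow_a kappa y = r ^ 2) by (symmetry; apply Csqrt_sqr).
pose (E := fun s => flow_lambda kappa y * flow_exp kappa s y).
assert (HE : cderiv all_times E t (r * E t)).
{ refine (cderiv_ext _ _ _ t _ _ _ _
    (cderiv_mult _ _ t _ _ (cderiv_const (flow_lambda kappa y) t) (cderiv_exp r t))).
  - reflexivity.
  - unfold E, flow_exp; fold r; ring. }
assert (HNe : forall s, phi_den kappa s y = (r ^ 2 + kappa ^ 2 + E s) ^ 2 - 4 * kappa ^ 2 * r ^ 2).
{ intros s; unfold phi_den, flow_b; rewrite Hr; reflexivity. }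
rewrite HNe in HN.
pose (N := fun s => (r ^ 2 + kappa ^ 2 + E s) ^ 2 - 4 * kappa ^ 2 * r ^ 2).
pose (q := fun s => 1 - 4 * r ^ 2 * E s / N s).
pose (P := fun s => r * ((r ^ 2 - kappa ^ 2) ^ 2 - E s ^ 2) / N s).
assert (HR : cderiv all_times q t ((q t - 1) * P t) /\
  cderiv all_times P t ((q t - 1) / 2 * (2 * kappa ^ 2 * q t + (r ^ 2 - kappa ^ 2))) /\
  P t ^ 2 = q t * (kappa ^ 2 * q t + (r ^ 2 - kappa ^ 2)))
  by exact (rational_curve r (kappa ^ 2) E t HE HN).
destruct HR as (Hq & HP & HPP).
assert (Hqe : forall s, phi_sq kappa s y = q s).
{ intros s; unfold phi_sq, q; rewrite HNe, Hr; unfold N, E, Cdiv; ring. }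
assert (HPe : forall s, flow_value kappa s y = P s * / phi kappa s y).
{ intros s; unfold flow_value, P; fold r; rewrite HNe, Hr; reflexivity. }
assert (Hn := half_plane_neq_0 _ Hphi).
assert (Hsq : q t = phi kappa t y ^ 2) by (rewrite <- Hqe; symmetry; apply Csqrt_sqr).
assert (Hd : cderiv all_times (fun s => phi kappa s y) t
    ((phi kappa t y ^ 2 - 1) / 2 * flow_value kappa t y)).
{ refine (cderiv_ext _ _ _ t _ _ _ _ (cderiv_sqrt q t _ _ Hq)).
  - intros s; unfold phi; now rewrite Hqe.
  - rewrite <- Hqe; fold (phi kappa t y); rewrite Hqe, HPe, Hsq; field; exact Hn.
  - rewrite <- Hqe; exact Hphi. }
rewrite Hsq in HP, HPP.
set (w := phi kappa t y) in *.
split; [exact Hd | split].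
- refine (cderiv_ext _ _ _ t _ _ _ _
    (cderiv_mult _ _ t _ _ HP (cderiv_inv (fun s => phi kappa s y) t _ Hn Hd))).
  + intros s; symmetry; apply HPe.
  + cbv beta; rewrite HPe; fold w.
    (* Quotient rule for [P / phi], arranged so that [P] occurs only through [P^2], which the
       quadratic relation eliminates. *)
    transitivity ((w ^ 2 - 1) / 2 * (2 * kappa ^ 2 * w ^ 2 + (r ^ 2 - kappa ^ 2)) / w
                  - (w ^ 2 - 1) * P t ^ 2 / (2 * w ^ 3)); [field; exact Hn |].
    rewrite HPP; field; exact Hn.
- rewrite HPe; fold w.
  replace ((P t * / w) ^ 2) with (P t ^ 2 / w ^ 2) by (field; exact Hn).
  rewrite HPP, <- Hr; unfold flow_a; field; exact Hn.
Qed.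

(** With [r = sqrt a] and [c = (1 - kappa^2) y^2], one has [r^2 = kappa^2 + c] and [(1 - kappa^2) (1
    - y^2) = (1 - r) (1 + r)]. Hence [lambda = c (1 - r) / (1 + r)], and the values at time 0
    simplify. *)
Lemma flow_initial (kappa : R) (y : C) :
  (-1 < kappa < 1)%R -> half_plane y ->
  phi kappa 0 y = y /\ flow_value kappa 0 y = y.
Proof.
intros Hk Hy.
assert (Hy0 := half_plane_neq_0 y Hy).
assert (Hk1 : 1 - RtoC kappa ^ 2 <> 0).
{ intros E; apply (f_equal Re) in E; unfold Re in E; simpl in E; nra. }
(* Vanishing would make [y^2] real and nonpositive, which is impossible for [Re y > 0]. With
   [1 + r <> 0], this keeps [phi_den] away from 0 at the start. *)
assert (Ha0 : flow_a kappa y <> 0).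
{ unfold half_plane in Hy; destruct y as [p s]; simpl in Hy; intros E.
  assert (E1 : (kappa * kappa + (1 - kappa * kappa) * (p * p - s * s) = 0)%R)
    by (transitivity (Re (flow_a kappa (p, s)));
        [unfold flow_a, Re; simpl; ring | now rewrite E]).
  assert (E2 : (2 * (p * s * (1 - kappa * kappa)) = 0)%R)
    by (transitivity (Im (flow_a kappa (p, s)));
        [unfold flow_a, Im; simpl; ring | now rewrite E]).
  assert (Hs : (p * s * (1 - kappa * kappa) = 0)%R) by lra.
  assert (Hs0 : (s = 0)%R).
  { apply Rmult_integral in Hs; destruct Hs as [Hs | Hs]; [| nra].
    apply Rmult_integral in Hs; destruct Hs; lra. }
  subst s; assert (0 < p * p * (1 - kappa * kappa))%R by (apply Rmult_lt_0_compat; nra).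
  nra. }
pose (r := Csqrt (flow_a kappa y)).
assert (Hr : flow_a kappa y = r ^ 2) by (symmetry; apply Csqrt_sqr).
assert (Hr0 : r <> 0) by (intros E; apply Ha0; rewrite Hr, E; ring).
assert (Hr1 : 1 + r <> 0).
{ intros E; apply (f_equal Re) in E.
  assert (H := proj1 (Csqrt_principal (flow_a kappa y))); fold r in H.
  change (1 + Re r = 0)%R in E; lra. }
set (c := (1 - RtoC kappa ^ 2) * y ^ 2).
assert (Hc0 : c <> 0) by (unfold c; repeat apply Cmult_neq_0; auto; simpl; repeat apply Cmult_neq_0; auto using C1_nz).
assert (Hrc : r ^ 2 = RtoC kappa ^ 2 + c) by (rewrite <- Hr; reflexivity).
assert (Hlam : flow_lambda kappa y * flow_exp kappa 0 y = c * (1 - r) / (1 + r)).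
{ assert (He : flow_exp kappa 0 y = 1).
  { unfold flow_exp; rewrite Cmult_0_r; unfold Cexp; simpl.
    rewrite exp_0, cos_0, sin_0; apply injective_projections; simpl; ring. }
  rewrite He; unfold flow_lambda; fold r.
  replace ((1 - kappa ^ 2) ^ 2 * y ^ 2 / (1 + r) ^ 2 * (1 - y ^ 2) * 1)
    with (c * ((1 - kappa ^ 2) - c) / (1 + r) ^ 2) by (unfold c; field; exact Hr1).
  replace (1 - kappa ^ 2 - c) with ((1 - r) * (1 + r)) by (ring_simplify; rewrite Hrc; ring).
  field; exact Hr1. }
assert (HN : phi_den kappa 0 y = 4 * c * r ^ 2 * (1 - kappa ^ 2) / (1 + r) ^ 2).
{ unfold phi_den, flow_b; rewrite Hlam, Hr.
  replace (RtoC kappa ^ 2) with (r ^ 2 - c) by (rewrite Hrc; ring).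
  field; exact Hr1. }
assert (H4 : RtoC 4 <> 0) by (intros E; apply RtoC_inj in E; lra).
assert (Hphi : phi kappa 0 y = y).
{ apply Csqrt_unique; [| exact Hy].
  unfold phi_sq; rewrite HN, Hr.
  replace (4 * r ^ 2 * flow_lambda kappa y * flow_exp kappa 0 y)
    with (4 * r ^ 2 * (flow_lambda kappa y * flow_exp kappa 0 y)) by ring.
  rewrite Hlam.
  replace (1 - 4 * r ^ 2 * (c * (1 - r) / (1 + r))
      / (4 * c * r ^ 2 * (1 - kappa ^ 2) / (1 + r) ^ 2))
    with ((r ^ 2 - kappa ^ 2) / (1 - kappa ^ 2))
    by (field; repeat split; auto).
  rewrite Hrc; unfold c; field; exact Hk1. }
split; [exact Hphi |].
unfold flow_value; fold r; rewrite Hphi, HN, Hlam, Hr.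
replace (r ^ 2 - kappa ^ 2) with c by (rewrite Hrc; ring).
replace y with (c / ((1 - kappa ^ 2) * y)) at 2 by (unfold c; field; auto).
field; repeat split; auto.
Qed.

(** * Comparison of the solution with the flow *)

Lemma solution_along_flow (kappa : R) (F : R -> C -> C) (y : C) (t : R) :
  (-1 < kappa < 1)%R -> pde_solution kappa F -> half_plane y -> (0 <= t)%R ->
  trajectory_in_half_plane kappa t y ->
  F t (phi kappa t y) = flow_value kappa t y.
Proof.
intros Hk HF Hy Ht Htr.
destruct (flow_initial kappa y Hk Hy) as (Hphi0 & Hval0).
pose (u := fun s => F s (phi kappa s y) + - (1) * flow_value kappa s y).
assert (Hu : u t = 0).
{ apply gronwall_zero; [exact Ht | |].
  - intros m Hm; destruct (Htr m Hm) as (HNm & Hpm).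
    destruct (flow_characteristic kappa m y HNm Hpm) as (Hdm & _).
    destruct (pde_along_curve kappa F (fun s => phi kappa s y) m HF ltac:(lra) Hpm)
      as (eta & K & Heta & HK & Hcurve).
    { eexists; exact Hdm. }
    (* Bound of [|(w^2 - 1) / 2 * c|] when [w] and [c] are both at most [K] in modulus. *)
    exists eta, ((K ^ 2 + 1) / 2 * K)%R; split; [exact Heta |].
    intros s Hs Hsm; destruct (Htr s Hs) as (HNs & Hps).
    destruct (flow_characteristic kappa s y HNs Hps) as (Hds & Hvs & _).
    destruct (Hcurve s _ ltac:(lra) Hsm Hds) as (c & Hc & Hw & Hder).
    set (w := phi kappa s y) in *; set (v := flow_value kappa s y) in *.
    (* The source term [kappa^2 / 2 * w * (w^2 - 1)] occurs in both derivatives and cancels; the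
       transport term [c * phi'] turns the factor [F] into [F - v], which is [u]. *)
    exists (- ((w ^ 2 - 1) / 2) * c * u s); split.
    + rewrite !Cmod_mult, Cmod_opp.
      apply Rmult_le_compat_r; [apply Cmod_ge_0 |].
      apply Rmult_le_compat; try apply Cmod_ge_0; [| exact Hc].
      assert (H2 : RtoC 2 <> 0) by (intros E; apply RtoC_inj in E; lra).
      rewrite Cmod_div, Cmod_R, (Rabs_right 2) by (exact H2 || lra).
      apply Rmult_le_compat_r; [lra |].
      eapply Rle_trans; [apply Cmod_triangle |].
      rewrite Cmod_opp, Cmod_1, Cmod_pow; apply Rplus_le_compat_r.
      apply pow_incr; split; [apply Cmod_ge_0 | exact Hw].
    + assert (Hneg := cderiv_mult _ _ s _ _ (cderiv_const (- (1)) s) Hvs).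
      apply (cderiv_weaken all_times time_domain) in Hneg; [| easy].
      refine (cderiv_ext _ _ _ s _ _ _ _ (cderiv_plus time_domain _ _ s _ _ Hder Hneg)).
      * reflexivity.
      * unfold u; fold w v; field.
  - unfold u; rewrite Hphi0, Hval0, (pde_initial _ _ HF y Hy); ring. }
replace (F t (phi kappa t y)) with (u t + flow_value kappa t y) by (unfold u; ring).
rewrite Hu; ring.
Qed.

(** The real part equals [(1 - |z|^2) / |1 - z|^2]. *)
Lemma disc_to_half_plane_half_plane (z : C) :
  (Cmod z < 1)%R -> half_plane (disc_to_half_plane z).
Proof.
intros Hz; unfold half_plane, disc_to_half_plane.
assert (H0 := Cmod_ge_0 z); assert (H := Cmod2_alt z).
destruct z as [p q]; unfold Re, Im in *; simpl in *.
assert (Hp : (p ^ 2 + q ^ 2 < 1)%R) by nra.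
assert (Hd : (0 < (1 - p) ^ 2 + q ^ 2)%R) by nra.
replace ((1 + p) * ((1 + - p) / ((1 + - p) * ((1 + - p) * 1) + (0 + - q) * ((0 + - q) * 1)))
  - (0 + q) * (- (0 + - q) / ((1 + - p) * ((1 + - p) * 1) + (0 + - q) * ((0 + - q) * 1))))%R
  with ((1 - p ^ 2 - q ^ 2) / ((1 - p) ^ 2 + q ^ 2))%R by (field; nra).
apply Rdiv_lt_0_compat; lra.
Qed.

Theorem theorem3 (kappa : R) (F : R -> C -> C)
    (hkappa : (-1 < kappa < 1)%R) (hF : pde_solution kappa F) :
  (forall y : C, half_plane y ->
     phi kappa 0 y = y /\
     forall t : R, (0 <= t)%R -> trajectory_in_half_plane kappa t y ->
       F t (phi kappa t y) ^ 2
         = kappa ^ 2 * phi kappa t y ^ 2 + (1 - kappa ^ 2) * y ^ 2) /\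
  (forall z : C, (Cmod z < 1)%R ->
     forall t : R, (0 <= t)%R ->
       trajectory_in_half_plane kappa t (disc_to_half_plane z) ->
       H_of F t (psi kappa t z) ^ 2
         = kappa ^ 2 * ((1 + psi kappa t z) / (1 - psi kappa t z)) ^ 2
           + (1 - kappa ^ 2) * ((1 + z) / (1 - z)) ^ 2).
Proof.
assert (Hmain : forall (y : C) (t : R), half_plane y -> (0 <= t)%R ->
  trajectory_in_half_plane kappa t y ->
  F t (phi kappa t y) ^ 2
    = kappa ^ 2 * phi kappa t y ^ 2 + (1 - kappa ^ 2) * y ^ 2).
{ intros y t Hy Ht Htr.
  rewrite (solution_along_flow kappa F y t) by assumption.
  destruct (Htr t ltac:(lra)) as (HN & Hp).
  apply (flow_characteristic kappa t y HN Hp). }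
split.
- intros y Hy; split; [now apply flow_initial |].
  intros t Ht Htr; now apply Hmain.
- intros z Hz t Ht Htr.
  destruct (Htr t ltac:(lra)) as (_ & Hp).
  (* The Cayley map sends [psi] back to [phi], so the disc statement is the half-plane one at
     [disc_to_half_plane z]. *)
  assert (Hpsi := half_plane_to_discK _ Hp); fold (psi kappa t z) in Hpsi.
  unfold H_of; rewrite Hpsi.
  change ((1 + psi kappa t z) / (1 - psi kappa t z))
    with (disc_to_half_plane (psi kappa t z)); rewrite Hpsi.
  apply (Hmain (disc_to_half_plane z)); [| exact Ht | exact Htr].
  now apply disc_to_half_plane_half_plane.
Qed.
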